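(* For every connected finite simple graph $G$ of order $n\ge 4$, $$ s(G)\ge \frac{3n}{4}.$$
   Context: All graphs are finite and simple (undirected, no loops or multiple edges). For a graph $G$ of order $n$ (i.e. with $n$ vertices), let $A(G)$ be its $n\times n$ adjacency matrix, with $(i,j)$ entry $1$ if the vertices $v_i$ and $v_j$ are adjacent and $0$ otherwise. The eigenvalues of $G$ are the eigenvalues of $A(G)$, which are real; list them with multiplicity as $\lambda_1(G)\ge\cdots\ge\lambda_n(G)$. The positive square energy and the negative square energy of $G$ are $$s^+(G)=\sum_{\lambda_i(G)>0}\lambda_i(G)^2,\qquad s^-(G)=\sum_{\lambda_i(G)<0}\lambda_i(G)^2,$$ and the square energy of $G$ is $s(G)=\min\{s^+(G),s^-(G)\}$. *)

(* Defs.v *)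
From mathcomp Require Import all_boot all_order all_algebra.
From mathcomp Require Import polyrcf.
From mathcomp Require Import reals.

Set Implicit Arguments.
Unset Strict Implicit.
Unset Printing Implicit Defensive.

Import Order.TTheory GRing.Theory Num.Theory.
Local Open Scope ring_scope.

Record sgraph := SGraph {
  vertex :> finType;
  adj : rel vertex;
  adj_sym : symmetric adj;
  adj_irrefl : irreflexive adj
}.

Definition graph_order (G : sgraph) : nat := #|G|.

Definition graph_connected (G : sgraph) : Prop := forall x y : G, connect (@adj G) x y.

Definition adjmx (R : realType) (G : sgraph) : 'M[R]_(graph_order G) :=
  \matrix_(i, j) (adj (enum_val i : G) (enum_val j : G))%:R.

(* The real eigenvalues of A, repeated according to their algebraic
   multiplicity, in nonincreasing order ([rootsR] lists the distinct real roots
   increasingly). When A is symmetric these are all its eigenvalues: the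
   characteristic polynomial then splits over R. *)
Definition eigenvalues (R : realType) (n : nat) (A : 'M[R]_n) : seq R :=
  flatten [seq nseq (mup x (char_poly A)) x | x <- rev (rootsR (char_poly A))].

Definition pos_square_energy (R : realType) (G : sgraph) : R :=
  \sum_(x <- eigenvalues (adjmx R G) | 0 < x) x ^+ 2.

Definition neg_square_energy (R : realType) (G : sgraph) : R :=
  \sum_(x <- eigenvalues (adjmx R G) | x < 0) x ^+ 2.

Definition square_energy (R : realType) (G : sgraph) : R :=
  Num.min (pos_square_energy R G) (neg_square_energy R G).

(* Main.v *)
Require Import Defs.
From mathcomp Require Import all_boot all_order all_algebra.
From mathcomp Require Import polyrcf complex.
From mathcomp Require Import reals ring lra ssrZ.

Set Implicit Arguments.
Unset Strict Implicit.
Unset Printing Implicit Defensive.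

Import Order.TTheory GRing.Theory Num.Theory.
Import BinInt.
Local Open Scope ring_scope.
Delimit Scope Z_scope with BZ.
Delimit Scope nat_scope with N.

(** Write the adjacency matrix as A = P - N with P and N positive semidefinite
and P N = 0.  For every positive semidefinite X,
  2 <A, X> - <X, X>  <=  2 <P, X> - <X, X>  <=  <P, P>,
and <P, P> is the sum of the squares of the positive eigenvalues; replacing A
by - A bounds the negative square energy in the same way ([energy_ge]).  So a
positive semidefinite X is a certificate for a lower bound on one of the two
energies.  The proof builds, for each sign, a certificate of value at least
3 n / 4.  It works with certificates supported on a vertex set S, and shows by
induction on |S| that every set S of at least 4 vertices that induces a
connected subgraph is [certifiable], meaning that it carries a certificate of
value at least 3 |S| / 4 for that sign.

Certificates can be combined.  Let P be a partition of S into K >= 2 bags and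
let each S \ B, for a bag B, carry a certificate X_B.  Two vertices lie together
in at most K - 1 of the sets S \ B, so by Cauchy-Schwarz the matrix
(sum of the X_B) / (K - 1) has value at least (sum of the values) / (K - 1).  As
the sizes of the sets S \ B add up to (K - 1) |S|, a bound proportional to the
size passes from the sets S \ B to S ([certified_partition]).  For K = 2 this is
the superadditivity of both energies over disjoint induced subgraphs; when S is
2-connected, it applies to the partition of S into single vertices.

Let S be connected with at least 5 vertices.  Suppose first that for every v in
S the set S \ v has a component D with at least 4 vertices.  If one of the bags
S \ D has at least 4 vertices too, then S splits into two smaller connected sets.
Otherwise the bags S \ D are laminar, so the maximal ones partition S, and the
induction hypothesis applies to their complements ([certified_bag_step]).

In the remaining case some vertex v, the hub, leaves only components with at
most 3 vertices.  If there are at least three of them, take a good certificate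
on each component and add one rank-one term, supported on v and one neighbour of
v in each component ([certified_star]); with at least four components the
counting is uniform in their number, with three it is a finite list of cases.
If there are two components, then S has at most 7 vertices and its induced
subgraph is one of a few small graphs up to some edges that may or may not be
present; for those, small integer matrices are certificates, and their value is
verified by computation ([check_certificate]).  The sets of 4 vertices, where
the bound is attained by the path and by the claw, are treated directly
([certifiable_four]). *)

(** * The spectrum of a real symmetric matrix *)

Section Spectrum.
Variable R : rcfType.
Local Open Scope sesquilinear_scope.
Local Notation C := (complex R).
Local Notation toC := (real_complex R).

Lemma mup_prod_XsubC (s : seq R) (x : R) :
  mup x (\prod_(a <- s) ('X - a%:P)) = count_mem x s.
Proof.
elim: s => [|a s IHs]; first by rewrite big_nil mupNroot // root1.
rewrite big_cons mupM ?polyXsubC_eq0 //; last first.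
  by rewrite monic_neq0 // monic_prod_XsubC.
by rewrite IHs -['X - a%:P]expr1 mup_XsubCX /= eq_sym; case: (a == x).
Qed.

(** The unitary diagonalization is taken over the complex numbers; the
eigenvalues of a Hermitian matrix being real, the factorization of the
characteristic polynomial descends to the reals. *)
Lemma symmetric_spectrum (n : nat) (A : 'M[R]_n) : A^T = A ->
  exists (U : 'M[C]_n) (e : 'I_n -> R),
    [/\ U \is unitarymx,
        A ^ toC = U ^t* *m diag_mx (\row_j (e j)%:C%C) *m U
      & char_poly A = \prod_j ('X - (e j)%:P)].
Proof.
move=> Asym; pose B := A ^ toC.
have Breal : B \is a realmx by apply/mxOverP => i j; rewrite mxE complex_real.
have Bsym : B \is symmetricmx.
  apply/is_hermitianmxP; rewrite expr0 scale1r map_mx_id //.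
  by apply/matrixP => i j; rewrite !mxE -[in LHS]Asym mxE.
have Bherm : B \is hermsymmx by exact: realsym_hermsym.
have /orthomx_spectralP := hermitian_normalmx Bherm.
set P := spectralmx B; set d := spectral_diag B => defB.
have Pu : P \is unitarymx by exact: spectral_unitarymx.
have dreal j : d 0 j \is Num.real.
  exact: (mxOverP (hermitian_spectral_diag_real Bherm)).
pose e j := complex.Re (d 0 j).
have def_d : d = \row_j (e j)%:C%C.
  by apply/rowP => j; rewrite mxE RRe_real.
exists P, e; split; first exact: Pu.
  by rewrite -def_d -(invmx_unitary Pu) -/B; exact: defB.
apply: (map_poly_inj toC).
rewrite map_char_poly -/B rmorph_prod /=.
have -> : char_poly B = char_poly (diag_mx d).
  have uP : P \in unitmx by exact: unitarymx_unit.
  have PK : map_mx polyC (invmx P) *m map_mx polyC P = 1%:M.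
    by rewrite -map_mxM mulVmx // map_mx1.
  have conjX : 'X%:M = map_mx polyC (invmx P) *m ('X%:M : 'M[{poly C}]_n)
                       *m map_mx polyC P.
    by rewrite -mulmxA -scalar_mxC mulmxA PK mul1mx.
  rewrite {1}defB /char_poly /char_poly_mx !map_mxM /= [in LHS]conjX.
  by rewrite -mulmxBl -mulmxBr !det_mulmx mulrAC -det_mulmx PK det1 mul1r.
rewrite char_poly_trig ?diag_mx_is_trig //.
apply: eq_bigr => j _; rewrite map_polyXsubC /= mxE eqxx mulr1n.
by rewrite def_d mxE.
Qed.

Lemma mxtrace_conjl (K : comPzRingType) n (D M U V : 'M[K]_n) :
  \tr (V *m D *m U *m M) = \tr (D *m (U *m M *m V)).
Proof. by rewrite -!mulmxA mxtrace_mulC !mulmxA. Qed.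

Lemma mxtrace_conj_sqr (K : comPzRingType) n (M U V : 'M[K]_n) :
  V *m U = 1%:M -> \tr (M *m M) = \tr ((U *m M *m V) *m (U *m M *m V)).
Proof.
move=> VU; rewrite -!mulmxA [V *m (U *m _)]mulmxA VU mul1mx.
by rewrite [RHS]mxtrace_mulC -!mulmxA VU mulmx1.
Qed.

(** With A = U^* diag(e) U for a unitary U, the weights w are the diagonal
entries of W = U X U^*, where X = Y^T Y.  They are nonnegative because W is
positive semidefinite, and their squares add up to at most the squared
Frobenius norm of W, which is that of X. *)
Lemma quadratic_spectrum (n : nat) (A : 'M[R]_n) : A^T = A ->
  exists2 e : 'I_n -> R, char_poly A = \prod_j ('X - (e j)%:P)
    & forall m (Y : 'M[R]_(m, n)), exists w : 'I_n -> R,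
        [/\ forall j, 0 <= w j, \tr (A *m (Y^T *m Y)) = \sum_j e j * w j
          & \sum_j w j ^+ 2 <= \tr ((Y^T *m Y) *m (Y^T *m Y))].
Proof.
move=> /symmetric_spectrum[U [e [Uu defA charA]]]; exists e => // m Y.
pose Z := map_mx toC Y *m U ^t*; pose W := Z ^t* *m Z.
have Ut : U ^t* *m U = 1%:M.
  by rewrite -(invmx_unitary Uu) mulVmx // unitarymx_unit.
have YtC : (map_mx toC Y) ^t* = map_mx toC Y^T.
  by apply/matrixP => i j; rewrite !mxE; apply/CrealP; rewrite complex_real.
have defW : W = U *m map_mx toC (Y^T *m Y) *m U ^t*.
  by rewrite /W /Z trmx_mul map_mxM trmxCK YtC map_mxM /= !mulmxA.
have W_C : W ^t* = W by rewrite /W trmx_mul map_mxM trmxCK.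
pose w j := \sum_k `|Z k j| ^+ 2.
have Wjj j : W j j = w j.
  by rewrite mxE; apply: eq_bigr => k _; rewrite !mxE normCK mulrC.
clearbody W; have w_ge0 j : 0 <= w j by apply: sumr_ge0 => k _; rewrite exprn_ge0.
pose v j := complex.Re (w j).
have def_w j : w j = (v j)%:C%C by rewrite RRe_real // ger0_real.
exists v; split.
- by move=> j; have := w_ge0 j; rewrite def_w ler0c.
- apply: (@complexI R); rewrite -(trace_map_mx toC) rmorph_sum map_mxM /= defA.
  transitivity (\tr (diag_mx (\row_j0 (e j0)%:C%C) *m W)).
    by rewrite defW; apply: mxtrace_conjl.
  rewrite mul_diag_mx; apply: eq_bigr => j _.
  by rewrite !mxE Wjj def_w -rmorphM.
- rewrite -lecR -(trace_map_mx toC) rmorph_sum map_mxM /=.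
  have -> : \tr (map_mx toC (Y^T *m Y) *m map_mx toC (Y^T *m Y)) = \tr (W *m W).
    by rewrite defW; apply: mxtrace_conj_sqr.
  rewrite -{2}W_C; apply: ler_sum => j _.
  rewrite mxE (bigD1 j) //= !mxE Wjj def_w.
  have -> : ((v j)%:C%C)^* = (v j)%:C%C by apply/CrealP; rewrite complex_real.
  rewrite -rmorphM -expr2 lerDl sumr_ge0 // => i _.
  by rewrite !mxE mul_conjC_ge0.
Qed.

Lemma count_eigenvalues (n : nat) (A : 'M[R]_n) (x : R) :
  count_mem x (flatten [seq nseq (mup y (char_poly A)) y
                       | y <- rev (rootsR (char_poly A))])
  = mup x (char_poly A).
Proof.
have pA0 : char_poly A != 0 by rewrite monic_neq0 ?char_poly_monic.
rewrite count_flatten -map_comp sumnE big_map.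
rewrite (perm_big (rootsR (char_poly A))) ?perm_rev //=.
have Ur : uniq (rootsR (char_poly A)) by exact: uniq_roots.
have mem_r : (x \in rootsR (char_poly A)) = root (char_poly A) x.
  by rewrite -(roots_on_rootsR pA0) in_itv.
case r_x: (root (char_poly A) x); last first.
  rewrite big1_seq ?mupNroot ?r_x // => y /= ry.
  rewrite count_nseq /= -[RHS](mul0n (mup y (char_poly A))); congr (_ * _)%N.
  by case: eqP => // xy; move: ry; rewrite xy mem_r r_x.
rewrite (bigD1_seq x) ?mem_r //= count_nseq /= eqxx mul1n big1 ?addn0 //.
by move=> y yx; rewrite count_nseq /= (negPf yx).
Qed.
End Spectrum.

Section EnergyBound.
Variable R : realType.

Lemma sum_eigenvalues (n : nat) (A : 'M[R]_n) (e : 'I_n -> R)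
    (P : pred R) (F : R -> R) :
  char_poly A = \prod_j ('X - (e j)%:P) ->
  \sum_(x <- eigenvalues A | P x) F x = \sum_(j | P (e j)) F (e j).
Proof.
move=> charA; rewrite -(big_map e P F).
apply/perm_big/allP => x _ /=; apply/eqP.
rewrite [LHS]count_eigenvalues charA -(big_map e xpredT (fun a => 'X - a%:P)).
exact: mup_prod_XsubC.
Qed.

(** In terms of the weights of [quadratic_spectrum], the left-hand side is at
most the sum of the 2 e_j w_j - w_j^2 with w_j >= 0.  Such a term is at most e_j^2,
and at most 0 when e_j <= 0. *)
Lemma energy_ge (n : nat) (A : 'M[R]_n) m (Y : 'M[R]_(m, n)) (X := Y^T *m Y) :
  A^T = A ->
  2%:R * \tr (A *m X) - \tr (X *m X) <= \sum_(x <- eigenvalues A | 0 < x) x ^+ 2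
  /\ - 2%:R * \tr (A *m X) - \tr (X *m X)
     <= \sum_(x <- eigenvalues A | x < 0) x ^+ 2.
Proof.
move=> /quadratic_spectrum[e charA /(_ m Y)[w [w_ge0 AX XX]]].
rewrite !(sum_eigenvalues _ _ charA) AX.
split.
- apply: (@le_trans _ _ (\sum_j (2%:R * (e j * w j) - w j ^+ 2))).
    by rewrite sumrB -mulr_sumr; lra.
  rewrite [leRHS]big_mkcond /= ler_sum // => j _; have wj := w_ge0 j.
  case: ltP => ej; first by have := sqr_ge0 (e j - w j); lra.
  by have := mulr_le0_ge0 ej wj; have := sqr_ge0 (w j); lra.
- apply: (@le_trans _ _ (\sum_j (- 2%:R * (e j * w j) - w j ^+ 2))).
    by rewrite sumrB -mulr_sumr; lra.
  rewrite [leRHS]big_mkcond /= ler_sum // => j _; have wj := w_ge0 j.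
  case: ltP => ej; first by have := sqr_ge0 (e j + w j); lra.
  by have := mulr_ge0 ej wj; have := sqr_ge0 (w j); lra.
Qed.
End EnergyBound.

(** * Certificates for lower bounds on the square energies *)

Section Certificates.
Variables (R : realType) (G : sgraph).
Implicit Types (X Z : G -> G -> R) (S : {set G}) (s : bool).

Definition adjf : G -> G -> R := fun u v => (adj u v)%:R.

Definition frob X Z : R := \sum_u \sum_v X u v * Z u v.

Definition gram (ys : seq (G -> R)) : G -> G -> R :=
  fun u v => \sum_(y <- ys) y u * y v.

Definition psd X := exists ys, X =2 gram ys.

(** The sign s is [false] for the positive and [true] for the negative square
energy. *)
Definition value s X : R := 2%:R * (-1) ^+ s * frob adjf X - frob X X.

Definition supported S X := forall u v, ~~ ((u \in S) && (v \in S)) -> X u v = 0.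

Definition certified s S (c : R) :=
  exists X, [/\ psd X, supported S X & c <= value s X].

Lemma frobC X Z : frob X Z = frob Z X.
Proof. by apply: eq_bigr => u _; apply: eq_bigr => v _; rewrite mulrC. Qed.

Lemma frobDr X Z Z' :
  frob X (fun u v => Z u v + Z' u v) = frob X Z + frob X Z'.
Proof.
rewrite -big_split; apply: eq_bigr => u _ /=; rewrite -big_split.
by apply: eq_bigr => v _ /=; rewrite mulrDr.
Qed.

Lemma frobZr X Z (a : R) : frob X (fun u v => a * Z u v) = a * frob X Z.
Proof.
rewrite mulr_sumr; apply: eq_bigr => u _; rewrite mulr_sumr.
by apply: eq_bigr => v _; rewrite mulrCA.
Qed.

Lemma frob_sumr X (I : finType) (P : pred I) (Z : I -> G -> G -> R) :
  frob X (fun u v => \sum_(i | P i) Z i u v) = \sum_(i | P i) frob X (Z i).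
Proof.
rewrite exchange_big /=; apply: eq_bigr => u _; rewrite exchange_big /=.
by apply: eq_bigr => v _; rewrite mulr_sumr.
Qed.

Lemma psd0 : psd (fun _ _ => 0).
Proof. by exists [::] => u v; rewrite /gram big_nil. Qed.

Lemma psdD X Z : psd X -> psd Z -> psd (fun u v => X u v + Z u v).
Proof.
by move=> [ys eX] [zs eZ]; exists (ys ++ zs) => u v; rewrite /gram big_cat eX eZ.
Qed.

Lemma psdZ (a : R) X : 0 <= a -> psd X -> psd (fun u v => a * X u v).
Proof.
move=> a0 [ys eX]; exists [seq (fun u => Num.sqrt a * y u) | y : G -> R <- ys].
move=> u v; rewrite /gram big_map eX mulr_sumr; apply: eq_bigr => y _.
by rewrite -{1}(sqr_sqrtr a0); ring.
Qed.

Lemma psd_sum (I : finType) (P : pred I) (Z : I -> G -> G -> R) :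
  (forall i, P i -> psd (Z i)) -> psd (fun u v => \sum_(i | P i) Z i u v).
Proof.
move=> psdZi; have: forall r : seq I, psd (fun u v => \sum_(i <- r | P i) Z i u v).
  elim=> [|i r IHr]; first by exists [::] => u v; rewrite /gram !big_nil.
  case Pi: (P i).
    have [ys e] := psdD (psdZi i Pi) IHr; exists ys => u v.
    by rewrite big_cons Pi e.
  by case: IHr => ys e; exists ys => u v; rewrite big_cons Pi e.
exact.
Qed.

Lemma psd_outer (y : G -> R) : psd (fun u v => y u * y v).
Proof. by exists [:: y] => u v; rewrite /gram big_seq1. Qed.

(** Cauchy-Schwarz against the constant family. *)
Lemma sqr_sum_le (I : finType) (P : pred I) (x : I -> R) :
  (\sum_(i | P i) x i) ^+ 2 <= #|P|%:R * \sum_(i | P i) x i ^+ 2.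
Proof.
set t := \sum_(i | P i) x i; set q := \sum_(i | P i) x i ^+ 2.
have: 0 <= \sum_(i | P i) (#|P|%:R * x i - t) ^+ 2.
  by apply: sumr_ge0 => i _; exact: sqr_ge0.
have -> : \sum_(i | P i) (#|P|%:R * x i - t) ^+ 2 = #|P|%:R * (#|P|%:R * q - t ^+ 2).
  transitivity (\sum_(i | P i) (#|P|%:R ^+ 2 * x i ^+ 2
                  + (- 2%:R * #|P|%:R * t) * x i + t ^+ 2)).
    by apply: eq_bigr => i _; ring.
  rewrite !big_split /= -!mulr_sumr -/t -/q sumr_const -mulr_natl.
  by ring.
have [P0|P_gt0] := posnP #|P|; last by rewrite pmulr_rge0 ?ltr0n // subr_ge0.
by move=> _; rewrite /t big_pred0 ?P0 ?expr0n ?mul0r //; exact: card0_eq.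
Qed.

Lemma certified_le s S c c' : c' <= c -> certified s S c -> certified s S c'.
Proof. by move=> cc' [X [? ? ?]]; exists X; split=> //; apply: le_trans cc' _. Qed.

(** The certificate is the sum of the X_B divided by K - 1, for K = #|P|.  Its
entry at (u, v) is a sum of at most K - 1 nonzero terms, since the bag of u
contributes 0; by Cauchy-Schwarz its square is at most 1 / (K - 1) times the sum
of the squares. *)
Lemma certified_bags s S (P : {set {set G}}) (c : {set G} -> R) :
  partition P S -> (1 < #|P|)%N ->
  (forall B, B \in P -> certified s (S :\: B) (c B)) ->
  certified s S ((\sum_(B in P) c B) / #|P|.-1%:R).
Proof.
move=> /and3P[/eqP covP trivP _] P_gt1 certP.
have K_gt0 : 0 < #|P|.-1%:R :> R by rewrite ltr0n -subn1 subn_gt0.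
set K : R := #|P|.-1%:R in K_gt0 *.
have /fin_all_exists[XB XBP] : forall B : {set G}, exists X,
    B \in P -> [/\ psd X, supported (S :\: B) X & c B <= value s X].
  move=> B; case: (boolP (B \in P)) => [/certP[X XP]|_]; last by exists adjf.
  by exists X.
pose X u v := K^-1 * \sum_(B in P) XB B u v.
have suppX : supported S X.
  move=> u v uvS; rewrite /X big1 ?mulr0 // => B /XBP[_ + _]; apply.
  by apply: contra uvS; rewrite !inE => /andP[/andP[_ ->] /andP[_ ->]].
exists X; split=> //.
  apply: psdZ; first by rewrite invr_ge0 ltW.
  by apply: psd_sum => B /XBP[].
have X_sqr u v : X u v * X u v <= K^-1 * \sum_(B in P) XB B u v * XB B u v.
  have [uS|uS] := boolP (u \in S); last first.
    rewrite suppX ?(negPf uS) // mulr0 mulr_ge0 ?invr_ge0 ?(ltW K_gt0) //.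
    by apply: sumr_ge0 => B _; rewrite -expr2 sqr_ge0.
  have PB : pblock P u \in P by rewrite pblock_mem ?covP.
  have XB0 v' : XB (pblock P u) u v' = 0.
    have [_ + _] := XBP _ PB; apply.
    by rewrite !inE mem_pblock covP uS.
  rewrite /X (bigD1 _ PB) /= XB0 add0r [X in _ <= _ * X](bigD1 _ PB) /= XB0 mul0r.
  rewrite add0r mulrACA -mulrA.
  rewrite ler_pM2l ?invr_gt0 // mulrC ler_pdivrMr // mulrC -expr2.
  apply: le_trans (sqr_sum_le _ _) _; rewrite le_eqVlt; apply/orP; left.
  apply/eqP; rewrite [RHS]mulrC; congr (_ * _).
  congr _%:R; rewrite (cardsD1 (pblock P u) P) PB /= -cardsE; apply: eq_card => B.
  by rewrite !inE andbC.
apply: (@le_trans _ _ (K^-1 * \sum_(B in P) value s (XB B))).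
  rewrite mulrC ler_pM2l ?invr_gt0 // ler_sum // => B /XBP[]//.
rewrite /value sumrB mulrBr frobZr frob_sumr lerB //.
  by rewrite -mulr_sumr; lra.
rewrite /frob [X in _ <= _ * X]exchange_big mulr_sumr ler_sum // => u _.
rewrite [X in _ <= _ * X]exchange_big mulr_sumr ler_sum // => v _; exact: X_sqr.
Qed.

Lemma certified_energy s (c : R) : certified s [set: G] c ->
  c <= (if s then neg_square_energy R G else pos_square_energy R G).
Proof.
move=> [X [[ys eX] _ c_le]].
pose Y : 'M[R]_(size ys, #|G|) :=
  \matrix_(i, j) nth (fun=> 0) ys i (enum_val j).
have Asym : (adjmx R G)^T = adjmx R G.
  by apply/matrixP => i j; rewrite !mxE adj_sym.
have YE i j : (Y^T *m Y) i j = X (enum_val i) (enum_val j).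
  rewrite mxE eX /gram (big_nth (fun=> 0)) big_mkord.
  by apply: eq_bigr => k _; rewrite !mxE.
have YC i j : (Y^T *m Y) i j = (Y^T *m Y) j i.
  by rewrite -[in LHS](trmxK (Y^T *m Y)) mxE trmx_mul trmxK.
have reindexE (F : G -> R) : \sum_(i < #|G|) F (enum_val i) = \sum_u F u.
  rewrite [RHS](reindex (@enum_val G xpredT)) //.
  by apply: onW_bij; exact: enum_val_bij.
have AX : \tr (adjmx R G *m (Y^T *m Y)) = frob adjf X.
  rewrite /frob -reindexE; apply: eq_bigr => i _; rewrite mxE -reindexE.
  by apply: eq_bigr => j _; rewrite YC YE mxE.
have XX : \tr ((Y^T *m Y) *m (Y^T *m Y)) = frob X X.
  rewrite /frob -reindexE; apply: eq_bigr => i _; rewrite mxE -reindexE.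
  by apply: eq_bigr => j _; rewrite [X in _ * X]YC !YE.
have [] := energy_ge Y Asym; rewrite AX XX => pos neg.
apply: le_trans c_le _; rewrite /value; case: s.
  by rewrite expr1 mulrN1; exact: neg.
by rewrite expr0 mulr1; exact: pos.
Qed.

End Certificates.

(** * The star certificate *)

Section Star.
Variables (R : realType) (G : sgraph).
Implicit Types (X Z : G -> G -> R) (S C : {set G}) (s : bool).

Definition outer (y : G -> R) : G -> G -> R := fun u v => y u * y v.

Lemma frob_outer (X : G -> G -> R) y :
  frob X (outer y) = \sum_u y u * \sum_v X u v * y v.
Proof.
apply: eq_bigr => u _; rewrite mulr_sumr; apply: eq_bigr => v _.
by rewrite mulrCA.
Qed.

Lemma frob_outer_outer y : frob (outer y) (outer y) = (\sum_u y u * y u) ^+ 2.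
Proof.
rewrite frob_outer expr2 mulr_suml; apply: eq_bigr => u _.
rewrite -mulrA; congr (_ * _); rewrite mulr_sumr; apply: eq_bigr => v _.
by rewrite /outer mulrA.
Qed.

Lemma value_rank_one s X y (c : R) :
  value s (fun u v => X u v + c * outer y u v) =
  value s X + 2%:R * c * ((-1) ^+ s * frob (@adjf R G) (outer y) - frob X (outer y))
  - c ^+ 2 * (\sum_u y u * y u) ^+ 2.
Proof.
pose U u v := X u v + c * outer y u v.
have frobU M : frob M U = frob M X + c * frob M (outer y).
  by rewrite frobDr frobZr.
rewrite /value -/U !frobU (frobC U) frobU (frobC U) frobU frob_outer_outer.
by rewrite (frobC (outer y) X); ring.
Qed.

Lemma value_sum s (P : {set {set G}}) (Z : {set G} -> G -> G -> R) :
  trivIset P -> (forall C, C \in P -> supported C (Z C)) ->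
  value s (fun u v => \sum_(C in P) Z C u v) = \sum_(C in P) value s (Z C).
Proof.
move=> trivP suppZ; rewrite /value frob_sumr sumrB -mulr_sumr; congr (_ - _).
rewrite frob_sumr; apply: eq_bigr => C CP; rewrite frobC frob_sumr.
rewrite (bigD1 _ CP) /= big1 ?addr0 // => D /andP[DP DC].
rewrite /frob big1 // => u _; rewrite big1 // => v _.
have [uC|uC] := boolP (u \in C); last by rewrite suppZ ?mul0r ?(negPf uC).
rewrite [Z D u v]suppZ ?mulr0 // negb_and.
have /trivIsetP/(_ _ _ DP CP DC) := trivP.
by move/disjointFl/(_ uC) => ->.
Qed.

(** The certificate is the sum of the certificates X_C of the blocks plus
c y y^T, where y takes the value r at v and +-b_C at the chosen neighbour a_C of v
in the block C.  The sign is that of the energy, so the edges v a_C all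
contribute positively to <A, y y^T>; since distinct blocks are not adjacent, no
other edge contributes.  The only interaction with the X_C is through their
diagonal entries at the a_C. *)
Lemma certified_star s (v : G) (P : {set {set G}}) (w d b : {set G} -> R)
    (r c : R) (N := r ^+ 2 + \sum_(C in P) b C ^+ 2) :
  trivIset P -> v \notin cover P ->
  (forall C D x y, C \in P -> D \in P -> C != D -> x \in C -> y \in D ->
     ~~ adj x y) ->
  (forall C, C \in P -> exists a X, [/\ a \in C, adj v a, psd X, supported C X
     & w C <= value s X /\ X a a <= d C]) ->
  0 <= c ->
  certified s (v |: cover P)
    (\sum_(C in P) w C
     + 2%:R * c * (2%:R * r * (\sum_(C in P) b C)
                   - \sum_(C in P) b C ^+ 2 * d C) - c ^+ 2 * N ^+ 2).
Proof.
move=> trivP vP noadj blk c_ge0.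
have /fin_all_exists[aX aXP] : forall C : {set G}, exists aX : G * (G -> G -> R),
    C \in P -> [/\ aX.1 \in C, adj v aX.1, psd aX.2, supported C aX.2
     & w C <= value s aX.2 /\ aX.2 aX.1 aX.1 <= d C].
  move=> C; case: (boolP (C \in P)) => [/blk[a [X aXC]]|_].
    by exists (a, X).
  by exists (v, fun _ _ => 0).
pose a C := (aX C).1; pose Z C := (aX C).2; pose sg : R := (-1) ^+ s.
have sg2 : sg * sg = 1 by rewrite /sg -expr2 sqrr_sign.
pose y u : R := r * (u == v)%:R + sg * \sum_(C in P) b C * (u == a C)%:R.
pose X0 u x := \sum_(C in P) Z C u x.
have suppZ C : C \in P -> supported C (Z C) by case/aXP.
have aC C : C \in P -> a C \in C by case/aXP.
have memP C x : C \in P -> x \in C -> x \in cover P.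
  by move=> CP xC; apply/bigcupP; exists C.
have neq_va C : C \in P -> (v == a C) = false.
  move=> CP; apply/negbTE; apply: contraNneq vP => ->.
  by apply: (memP C); rewrite ?aC.
have disj C D x : C \in P -> D \in P -> x \in C -> x \in D -> C = D.
  move=> CP DP xC xD; apply/eqP; apply: contraTT xC => CD.
  have /trivIsetP/(_ _ _ CP DP CD) := trivP.
  by move/disjointFl/(_ xD) => ->.
have delta (F : G -> R) x : \sum_u F u * (u == x)%:R = F x.
  rewrite (bigD1 x) //= eqxx mulr1 big1 ?addr0 // => u /negPf->.
  by rewrite mulr0.
have ysum F : \sum_u F u * y u = r * F v + sg * \sum_(C in P) b C * F (a C).
  rewrite -(delta F v) mulr_sumr mulr_sumr.
  under [X in _ + X]eq_bigr do rewrite -delta !mulr_sumr.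
  rewrite exchange_big -big_split; apply: eq_bigr => u _ /=.
  rewrite mulrDr !mulr_sumr; congr (_ + _); first by ring.
  by apply: eq_bigr => C _; ring.
have ysumC F : \sum_u y u * F u = r * F v + sg * \sum_(C in P) b C * F (a C).
  by rewrite -ysum; apply: eq_bigr => u _; rewrite mulrC.
have yv : y v = r.
  rewrite /y eqxx mulr1 big1 ?mulr0 ?addr0 // => C /neq_va->.
  by rewrite mulr0.
have ya C : C \in P -> y (a C) = sg * b C.
  move=> CP; rewrite /y eq_sym neq_va // mulr0 add0r; congr (_ * _).
  rewrite (bigD1 C) //= eqxx mulr1 big1 ?addr0 // => D /andP[DP DC].
  case: eqP => [aCD|]; last by rewrite mulr0.
  by rewrite (disj _ _ (a C) CP DP) ?aC ?aCD ?aC ?eqxx in DC *.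
have yy : \sum_u y u * y u = N.
  rewrite ysum yv -expr2; congr (_ + _); rewrite mulr_sumr.
  by apply: eq_bigr => C CP; rewrite ya // -[RHS]mul1r -sg2; ring.
have Ayy : sg * frob (@adjf R G) (outer y) = 2%:R * r * \sum_(C in P) b C.
  have Av : \sum_x adjf R v x * y x = sg * \sum_(C in P) b C.
    rewrite ysum /adjf adj_irrefl mulr0 add0r; congr (_ * _).
    by apply: eq_bigr => C /aXP[_ -> _ _ _]; rewrite mulr1.
  have Aa C : C \in P -> \sum_x adjf R (a C) x * y x = r.
    move=> CP; rewrite ysum /adjf adj_sym; have [_ -> _ _ _] := aXP C CP.
    rewrite mulr1 big1 ?mulr0 ?addr0 // => D DP.
    have [<-|CD] := eqVneq C D; first by rewrite adj_irrefl mulr0.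
    by rewrite (negPf (noadj C D _ _ CP DP CD _ _)) ?mulr0 ?aC.
  rewrite frob_outer ysumC Av.
  have -> : \sum_(C in P) b C * (\sum_x adjf R (a C) x * y x)
            = \sum_(C in P) b C * r by apply: eq_bigr => C CP; rewrite Aa.
  rewrite -mulr_suml; set B := \sum_(C in P) b C.
  by transitivity (sg * sg * (2%:R * r * B)); [ring | rewrite sg2 mul1r].
have X0v x : X0 v x = 0.
  rewrite /X0 big1 // => C CP; rewrite suppZ //; apply: contra vP => /andP[vC _].
  exact: memP vC.
have X0a C x : C \in P -> X0 (a C) x = Z C (a C) x.
  move=> CP; rewrite /X0 (bigD1 C) //= big1 ?addr0 // => D /andP[DP DC].
  rewrite suppZ //; apply: contra DC => /andP[aD _].
  by rewrite (disj _ _ _ DP CP aD) ?aC.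
have Xyy : frob X0 (outer y) <= \sum_(C in P) b C ^+ 2 * d C.
  have Xa C : C \in P -> \sum_x X0 (a C) x * y x = sg * (b C * Z C (a C) (a C)).
    move=> CP; rewrite ysum !X0a // [Z C (a C) v]suppZ // ?mulr0 ?add0r; last first.
      by rewrite negb_and orbC; apply/orP; left; apply: contra vP; apply: memP.
    rewrite (bigD1 C) //= big1 ?addr0 ?X0a // => D /andP[DP DC].
    rewrite X0a // suppZ ?mulr0 //; apply: contra DC => /andP[_ aD].
    by rewrite (disj _ _ (a D) DP CP) ?aC.
  rewrite frob_outer ysumC [X in r * X]big1 => [|x _]; last by rewrite X0v mul0r.
  rewrite mulr0 add0r mulr_sumr ler_sum // => C CP.
  rewrite Xa // (_ : _ * _ = sg * sg * (b C ^+ 2 * Z C (a C) (a C))); last by ring.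
  rewrite sg2 mul1r ler_wpM2l ?sqr_ge0 //.
  by have [_ _ _ _ []] := aXP C CP.
exists (fun u x => X0 u x + c * outer y u x); split.
- apply: psdD; first by apply: psd_sum => C /aXP[].
  by apply: psdZ => //; exact: psd_outer.
- move=> u x; rewrite !inE => ux.
  have y0 z : ~~ ((z == v) || (z \in cover P)) -> y z = 0.
    rewrite negb_or => /andP[/negPf zv zP]; rewrite /y zv mulr0 add0r.
    rewrite big1 ?mulr0 // => C CP; case: eqP => [za|]; last by rewrite mulr0.
    by rewrite za (memP C) ?aC in zP.
  have -> : outer y u x = 0.
    move: ux; rewrite negb_and /outer => /orP[/y0->|/y0->];
    by rewrite ?mul0r ?mulr0.
  rewrite mulr0 addr0 /X0 big1 // => C CP; rewrite suppZ //.
  apply: contra ux => /andP[uC xC].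
  by rewrite !(memP C) // !orbT.
rewrite value_rank_one -/sg yy Ayy value_sum //.
rewrite lerD2r lerD //; first by apply: ler_sum => C /aXP[_ _ _ _ []].
by apply: ler_wpM2l; [exact: mulr_ge0 | exact: lerB].
Qed.

End Star.

(** * Integer certificates verified by computation *)

Section IntegerCertificates.

(** Integer matrices indexed by positions in a list of vertices.  The sums are
plain recursions, so that [check] evaluates. *)
Definition zsum n (f : nat -> Z) : Z :=
  foldr (fun i acc => Z.add (f i) acc) 0%BZ (iota 0 n).

Definition zgram (B : seq (seq Z)) i j : Z :=
  foldr (fun y acc => Z.add (Z.mul (nth 0%BZ y i) (nth 0%BZ y j)) acc) 0%BZ B.

Definition listed (E : seq (nat * nat)) i j := ((i, j) \in E) || ((j, i) \in E).

(** Lower bound for the contribution of the pair (i, j) to the linear part of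
the value: E lists the edges, U the pairs that may or may not be edges, and the
worst case is taken over the pairs in U. *)
Definition zentry (s : bool) E U B i j : Z :=
  let g := if s then Z.opp (zgram B i j) else zgram B i j in
  if i == j then 0%BZ else if listed U i j then Z.min 0 g else if listed E i j then g else 0%BZ.

(** The certificate is (1 / D) times the Gram matrix of the rows of B; [check]
verifies that its value is at least p / q for every graph described by E and U. *)
Definition check (s : bool) n (E U : seq (nat * nat)) D B p q : bool :=
  [&& all (fun y : seq Z => size y <= n)%N B, Z.ltb 0 D, Z.ltb 0 q &
  Z.leb (p * (D * D))%BZ
   (q * (zsum n (fun i => zsum n (fun j =>
      2 * D * zentry s E U B i j - zgram B i j * zgram B i j))))%BZ].

Variables (R : realType) (G : sgraph).

Definition realizes (x0 : G) (vs : seq G) (E U : seq (nat * nat)) : bool :=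
  all (fun i => all (fun j => (i < j)%N ==> (listed U i j ||
    (adj (nth x0 vs i) (nth x0 vs j) == listed E i j))) (iota 0 (size vs)))
    (iota 0 (size vs)).

Lemma frob_list (M X : G -> G -> R) (x0 : G) (vs : seq G) :
  uniq vs -> supported [set x in vs] X ->
  frob M X = \sum_(0 <= i < size vs) \sum_(0 <= j < size vs)
     M (nth x0 vs i) (nth x0 vs j) * X (nth x0 vs i) (nth x0 vs j).
Proof.
move=> Uvs suppX.
have sum_vs (F : G -> R) : (forall u, u \notin vs -> F u = 0) ->
    \sum_u F u = \sum_(0 <= i < size vs) F (nth x0 vs i).
  move=> F0; transitivity (\sum_(u in vs) F u).
    by rewrite [LHS](bigID (mem vs)) /= [X in _ + X]big1 ?addr0.
  by rewrite -big_uniq // (big_nth x0).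
rewrite /frob sum_vs => [|u uN]; last first.
  by rewrite big1 // => v _; rewrite suppX ?mulr0 // inE (negPf uN).
apply: eq_bigr => i _; rewrite sum_vs // => u uN.
by rewrite suppX ?mulr0 // !inE (negPf uN) andbF.
Qed.

Definition list_gram (vs : seq G) (B : seq (seq R)) (a : R) : G -> G -> R :=
  fun u v => a * \sum_(y <- B) y`_(index u vs) * y`_(index v vs).

Lemma psd_list_gram vs B a : 0 <= a -> psd (list_gram vs B a).
Proof.
move=> a0; have [ys e] : psd (gram [seq (fun u : G => y`_(index u vs)) | y : seq R <- B]).
  by exists [seq (fun u : G => y`_(index u vs)) | y : seq R <- B].
apply: psdZ a0 _; exists ys => u v; rewrite -e.
by rewrite /gram big_map.
Qed.

Lemma supported_list_gram vs B a :
  all (fun y : seq R => size y <= size vs)%N B ->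
  supported [set x in vs] (list_gram vs B a).
Proof.
move=> /allP sB u v; rewrite !inE negb_and => uv.
have y0 x y : x \notin vs -> y \in B -> y`_(index x vs) = 0.
  by move=> xN /sB sy; rewrite nth_default // memNindex.
rewrite /list_gram big1_seq ?mulr0 // => y /= yB.
by case/orP: uv => /y0->; rewrite ?mul0r ?mulr0.
Qed.

Lemma value_list_gram s (x0 : G) vs B a (g := fun i j => a * \sum_(y <- B) y`_i * y`_j) :
  uniq vs -> all (fun y : seq R => size y <= size vs)%N B ->
  value s (list_gram vs B a) =
    \sum_(0 <= i < size vs) \sum_(0 <= j < size vs)
       (2%:R * ((-1) ^+ s * adjf R (nth x0 vs i) (nth x0 vs j) * g i j)
        - g i j ^+ 2).
Proof.
move=> Uvs /supported_list_gram suppX.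
rewrite /value !(frob_list _ x0 Uvs (suppX a)) mulr_sumr -sumrB.
rewrite !big_seq; apply: eq_bigr => i; rewrite mem_index_iota => /= i_lt.
rewrite mulr_sumr -sumrB !big_seq; apply: eq_bigr => j.
rewrite mem_index_iota => /= j_lt.
by rewrite /list_gram /g !index_uniq //; ring.
Qed.

Definition ZtoR (z : Z) : R := (int_of_Z z)%:~R.

Lemma ZtoRD a b : ZtoR (Z.add a b) = ZtoR a + ZtoR b.
Proof. by rewrite /ZtoR -rmorphD /= -[in RHS]rmorphD. Qed.

Lemma ZtoRM a b : ZtoR (Z.mul a b) = ZtoR a * ZtoR b.
Proof. by rewrite /ZtoR -rmorphM /= -[in RHS]rmorphM. Qed.

Lemma ZtoRN a : ZtoR (Z.opp a) = - ZtoR a.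
Proof. by rewrite /ZtoR -rmorphN /= -[in RHS]rmorphN. Qed.

Lemma ZtoR_nat n : ZtoR (Z.of_nat n) = n%:R.
Proof. by case: n => [|n] //=; rewrite /ZtoR /= SuccNat2Pos.id_succ. Qed.

Lemma ZtoR_ge0 a : (0 <= a)%BZ -> 0 <= ZtoR a.
Proof. by case: a => [|p|p] //= _; rewrite /ZtoR /= ?ler0n. Qed.

Lemma ZtoR_le a b : (a <= b)%BZ -> ZtoR a <= ZtoR b.
Proof.
move=> ab; rewrite -subr_ge0 -ZtoRN -ZtoRD; apply: ZtoR_ge0.
exact/Z.le_0_sub.
Qed.

Lemma ZtoR_sum n (f : nat -> Z) : ZtoR (zsum n f) = \sum_(0 <= i < n) ZtoR (f i).
Proof.
rewrite /zsum /index_iota subn0; elim: (iota 0 n) => [|i r IHr]; first by rewrite big_nil.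
by rewrite big_cons /= ZtoRD IHr.
Qed.

Lemma ZtoR_gt0 a : (0 < a)%BZ -> 0 < ZtoR a.
Proof.
move=> a0; rewrite lt_neqAle ZtoR_ge0 ?andbT; last exact: Z.lt_le_incl.
case: a a0 => //= p _; rewrite /ZtoR /= eq_sym pnatr_eq0.
  by rewrite -lt0n; apply/ssrnat.ltP; exact: Pnat.Pos2Nat.is_pos.
Qed.

Lemma check_certificate s (x0 : G) (vs : seq G) E U D B p q :
  uniq vs -> realizes x0 vs E U -> check s (size vs) E U D B p q ->
  exists X, [/\ psd X, supported [set x in vs] X, ZtoR p / ZtoR q <= value s X &
    forall i, (i < size vs)%N ->
      X (nth x0 vs i) (nth x0 vs i) = ZtoR (zgram B i i) / ZtoR D].
Proof.
move=> Uvs /allP real /and4P[sB /Z.ltb_lt/ZtoR_gt0 D_gt0 /Z.ltb_lt/ZtoR_gt0 q_gt0 /Z.leb_le ineq].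
pose BR : seq (seq R) := [seq [seq ZtoR z | z <- y] | y <- B].
have nth_ZtoR (y : seq Z) k : ZtoR (nth 0%BZ y k) = [seq ZtoR z | z <- y]`_k.
  by elim: y k => [|z y IHy] [|k] //=.
have gE i j : ZtoR (zgram B i j) = \sum_(y <- BR) y`_i * y`_j.
  rewrite big_map /zgram; elim: (B) => [|y r IHr]; first by rewrite big_nil.
  by rewrite big_cons /= ZtoRD IHr ZtoRM !nth_ZtoR.
have sBR : all (fun y : seq R => size y <= size vs)%N BR.
  by rewrite all_map; apply: sub_all sB => y /=; rewrite size_map.
have a_ge0 : 0 <= (ZtoR D)^-1 by rewrite invr_ge0 ltW.
exists (list_gram vs BR (ZtoR D)^-1); split; last 1 first.
- by move=> i i_lt; rewrite /list_gram index_uniq // -gE mulrC.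
- exact: psd_list_gram.
- exact: supported_list_gram.
rewrite (@value_list_gram s x0) //.
have adjE i j : (i < size vs)%N -> (j < size vs)%N ->
    ZtoR (zentry s E U B i j)
    <= (-1) ^+ s * adjf R (nth x0 vs i) (nth x0 vs j) * ZtoR (zgram B i j).
  move=> i_lt j_lt.
  rewrite /zentry; case: eqVneq => [->|ij].
    by rewrite /adjf adj_irrefl mulr0 mul0r.
  have realE k l : (k < size vs)%N -> (l < size vs)%N -> (k < l)%N ->
      listed U k l \/ adj (nth x0 vs k) (nth x0 vs l) = listed E k l.
    move=> k_lt l_lt kl; have := real k; rewrite mem_iota /= => /(_ k_lt)/allP/(_ l).
    by rewrite mem_iota /= kl => /(_ l_lt)/orP[->|/eqP]; [left | right].
  have listedC F k l : listed F k l = listed F l k by rewrite /listed orbC.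
  have adj_or : listed U i j \/ adj (nth x0 vs i) (nth x0 vs j) = listed E i j.
    case: (ltngtP i j) ij => // [lt_ij|lt_ji] _; first exact: realE.
    by rewrite !(listedC _ i) adj_sym; exact: realE.
  have ZtoRg : ZtoR (if s then Z.opp (zgram B i j) else zgram B i j)
              = (-1) ^+ s * ZtoR (zgram B i j).
    by case: (s); rewrite ?ZtoRN ?expr1 ?mulN1r ?expr0 ?mul1r.
  rewrite mulrAC -ZtoRg /adjf; set g := if s then _ else _.
  case: adj_or => [->|->].
    case: adj; rewrite ?mulr1 ?mulr0.
      by apply: ZtoR_le; exact: Z.le_min_r.
    by rewrite -[leRHS]/(ZtoR 0%BZ); apply: ZtoR_le; exact: Z.le_min_l.
  case: (listed U i j); case: (listed E i j) => //=; rewrite ?mulr1 ?mulr0 //.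
    by apply: ZtoR_le; exact: Z.le_min_r.
  by rewrite -[leRHS]/(ZtoR 0%BZ); apply: ZtoR_le; exact: Z.le_min_l.
have /ZtoR_le := ineq; rewrite !ZtoRM !ZtoR_sum.
set t := (X in _ <= ZtoR q * X) => ineqR.
apply: (@le_trans _ _ (t * (ZtoR D)^-1 ^+ 2)).
  rewrite exprVn ler_pdivrMr // mulrAC ler_pdivlMr ?exprn_gt0 //.
  by rewrite expr2 [leRHS]mulrC.
rewrite /t mulr_suml !big_seq ler_sum // => i; rewrite mem_index_iota => /andP[_ i_lt].
rewrite ZtoR_sum mulr_suml !big_seq ler_sum // => j; rewrite mem_index_iota => /andP[_ j_lt].
rewrite ZtoRD ZtoRN !ZtoRM -gE.
have := adjE i j i_lt j_lt; set z := ZtoR (zentry _ _ _ _ _ _); set w := _ * adjf R _ _ => zw.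
have -> : ZtoR 2%BZ = 2%:R by [].
rewrite -subr_ge0 (_ : _ - _ = 2%:R * (ZtoR D)^-1 * (w * ZtoR (zgram B i j) - z)).
  apply: mulr_ge0; last by rewrite subr_ge0.
  by apply: mulr_ge0 => //; rewrite invr_ge0 ltW.
by field; rewrite gt_eqF.
Qed.

End IntegerCertificates.

(** * Connected vertex sets and their components *)

Section Connectivity.
Variable G : sgraph.
Implicit Types (S T A B C D : {set G}) (x y v : G).

(** Connectivity of the induced subgraph, by cuts rather than by paths: adding a
vertex, or removing a component, then only requires to follow one subset. *)
Definition conn S : bool :=
  [forall T : {set G}, (T != set0) && (T \proper S) ==>
     [exists x in T, exists y in S :\: T, adj x y]].

Lemma connP S :
  reflect (forall T, T != set0 -> T \proper S ->
             exists x y, [/\ x \in T, y \in S, y \notin T & adj x y])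
          (conn S).
Proof.
apply: (iffP forallP) => [cS T T0 TS|cS T].
  have := cS T; rewrite T0 TS /= => /exists_inP[x xT /exists_inP[y]].
  by rewrite inE => /andP[yT yS] xy; exists x, y.
apply/implyP => /andP[T0 TS]; have [x [y [xT yS yT xy]]] := cS T T0 TS.
apply/exists_inP; exists x => //; apply/exists_inP; exists y => //.
by rewrite inE yT.
Qed.

Lemma conn1 x : conn [set x].
Proof.
apply/connP => T T0; rewrite properEcard cards1 subset1 => /andP[+ T1].
by rewrite (negPf T0) orbF => /eqP Tx; rewrite Tx cards1 in T1.
Qed.

(** If T meets A without containing it, an edge of A leaves T, and likewise for
B.  Otherwise T contains one of A and B and misses the other, so x = y is
impossible and the edge x y leaves T. *)
Lemma connU A B x y : conn A -> conn B -> x \in A -> y \in B ->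
  (x == y) || adj x y -> conn (A :|: B).
Proof.
have escape C T : conn C -> T :&: C != set0 -> ~~ (C \subset T) ->
    exists z w, [/\ z \in T, w \in C, w \notin T & adj z w].
  move=> /connP cC TC0 CT.
  have TC : T :&: C \proper C.
    by rewrite properE subsetIr subsetI subxx andbT.
  have [z [w [zT wC wT zw]]] := cC _ TC0 TC; exists z, w; split=> //.
    by case/setIP: zT.
  by move: wT; rewrite inE wC andbT.
move=> cA cB xA yB xy; apply/connP => T T0 TS.
suff [[z [w [zT wA wT zw]]]|[z [w [zT wB wT zw]]]|//] :
  [\/ exists z w, [/\ z \in T, w \in A, w \notin T & adj z w],
      exists z w, [/\ z \in T, w \in B, w \notin T & adj z w]
    | exists z w, [/\ z \in T, w \in A :|: B, w \notin T & adj z w]].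
- by exists z, w; rewrite inE wA.
- by exists z, w; rewrite inE wB orbT.
have [AT|AT] := boolP (A \subset T); last first.
  have [TA|TA] := eqVneq (T :&: A) set0; last by constructor 1; exact: escape.
  have TB : T \subset B.
    apply/subsetP => u uT; have := subsetP (proper_sub TS) u uT.
    rewrite inE => /orP[uA|//].
    by have := in_set0 u; rewrite -TA inE uT uA.
  have [BT|BT] := boolP (B \subset T); last first.
    by constructor 2; apply: escape => //; rewrite (setIidPl TB).
  constructor 3; exists y, x; rewrite (subsetP BT) // inE xA; split=> //.
    by apply: contraL xA => xT; apply/negP => xA; have := in_set0 x;
       rewrite -TA inE xT xA.
  case/orP: xy => [/eqP xy|]; last by rewrite adj_sym.
  by have := in_set0 x; rewrite -TA inE xA xy (subsetP BT).
have BT : ~~ (B \subset T).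
  by move: TS; rewrite properE => /andP[_]; rewrite subUset AT.
have [TB|TB] := eqVneq (T :&: B) set0; last by constructor 2; exact: escape.
have yT : y \notin T.
  by apply/negP => yT; have := in_set0 y; rewrite -TB inE yT yB.
constructor 3; exists x, y; rewrite (subsetP AT) // inE yB orbT; split=> //.
by case/orP: xy => // /eqP xy; rewrite -xy (subsetP AT) in yT.
Qed.

Lemma graph_connected_conn : graph_connected G -> conn [set: G].
Proof.
move=> cG; apply/connP => T /set0Pn[x xT]; rewrite properT => TN.
have /existsP[y yT] : [exists y, y \notin T].
  apply: contraR TN; rewrite negb_exists => /forallP allT.
  by apply/eqP/setP => y; rewrite inE; have := allT y; rewrite negbK.
have [[z w] /= /and3P[zT wT zw]|noedge] :=
    pickP [pred p : G * G | [&& p.1 \in T, p.2 \notin T & adj p.1 p.2]].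
  by exists z, w; rewrite inE.
have closedT : closed (@adj G) (mem T).
  have half z w : adj z w -> z \in T -> w \in T.
    move=> zw zT; have := noedge (z, w); rewrite /= zT zw andbT => /negbT.
    by rewrite negbK.
  move=> z w zw; apply/idP/idP; first exact: half.
  by apply: half; rewrite adj_sym.
by have := closed_connect closedT (cG x y); rewrite xT (negPf yT).
Qed.

Definition comps S : {set {set G}} :=
  [set D : {set G} | maxset [pred C : {set G} | [&& C != set0, conn C & C \subset S]] D].

Lemma compsP S D : D \in comps S -> [/\ D != set0, conn D & D \subset S].
Proof. by rewrite inE => /maxsetp/and3P. Qed.

Lemma comps_absorb S C D x y : D \in comps S -> conn C -> C \subset S ->
  x \in C -> y \in D -> (x == y) || adj x y -> C \subset D.
Proof.
move=> DS cC CS xC yD xy; have [D0 cD sDS] := compsP DS.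
move: DS; rewrite inE => /maxsetP[_ maxD].
rewrite -(maxD (C :|: D)) ?subsetUl ?subsetUr //=.
rewrite (connU cC cD xC yD xy) subUset CS sDS !andbT.
by apply/set0Pn; exists x; rewrite inE xC.
Qed.

Lemma comps_eq S C D x y : C \in comps S -> D \in comps S ->
  x \in C -> y \in D -> (x == y) || adj x y -> C = D.
Proof.
move=> CS DS xC yD xy; have [_ cC sC] := compsP CS; have [_ cD sD] := compsP DS.
apply/eqP; rewrite eqEsubset (comps_absorb DS cC sC xC yD xy).
by apply: (comps_absorb CS cD sD yD xC); rewrite eq_sym adj_sym.
Qed.

Lemma mem_comps S x : x \in S -> exists2 D, D \in comps S & x \in D.
Proof.
move=> xS.
have [|D maxD xD] := @maxset_exists _
    [pred C : {set G} | [&& C != set0, conn C & C \subset S]] [set x].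
  by rewrite /= conn1 sub1set xS !andbT; apply/set0Pn; exists x; rewrite inE.
by exists D; [rewrite inE | rewrite -sub1set].
Qed.

Lemma comps_trivIset S : trivIset (comps S).
Proof.
apply/trivIsetP => C D CS DS; apply: contraR => /pred0Pn[x /andP[xC xD]].
by apply/eqP/(comps_eq CS DS xC xD); rewrite eqxx.
Qed.

Lemma cover_comps S : cover (comps S) = S.
Proof.
apply/setP => x; apply/bigcupP/idP => [[D /compsP[_ _ /subsetP DS]]|]; first exact: DS.
by move=> /mem_comps[D DS xD]; exists D.
Qed.

Lemma comps_edge S v D : conn S -> v \in S -> D \in comps (S :\ v) ->
  exists2 a, a \in D & adj v a.
Proof.
move=> /connP cS vS DS; have [D0 cD sD] := compsP DS.
have [|x [y [xD yS yD xy]]] := cS D D0.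
  rewrite properE (subset_trans sD) ?subsetDl //=; apply/subsetPn; exists v => //.
  by apply/negP => /(subsetP sD); rewrite !inE eqxx.
have [<-|yv] := eqVneq y v; first by exists x; rewrite // adj_sym.
have: [set y] \subset D.
  apply: (comps_absorb DS (conn1 y) _ (set11 y) xD); last by rewrite adj_sym xy orbT.
  by rewrite sub1set !inE yv.
by rewrite sub1set (negPf yD).
Qed.

(** A set that avoids v and the component D can be left only through an edge
that does not end in D; a set that contains v is handled through its complement. *)
Lemma conn_compl S v D : conn S -> v \in S -> D \in comps (S :\ v) ->
  conn (S :\: D).
Proof.
move=> /connP cS vS DS; have [D0 cD sD] := compsP DS.
have noedge x y : x \in D -> y \in S -> y \notin D -> y != v -> ~~ adj x y.
  move=> xD yS yD yv; apply: contra yD => xy; rewrite -sub1set.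
  apply: (comps_absorb DS (conn1 y) _ (set11 y) xD); last by rewrite adj_sym xy orbT.
  by rewrite sub1set !inE yv.
have vD : v \notin D by apply/negP => /(subsetP sD); rewrite !inE eqxx.
have main T : T != set0 -> T \subset S :\: D -> v \notin T ->
    exists x y, [/\ x \in T, y \in S :\: D, y \notin T & adj x y].
  move=> T0 TS vT; have [|x [y [xT yS yT xy]]] := cS T T0.
    rewrite properE (subset_trans TS) ?subsetDl //=.
    by apply/subsetPn; exists v.
  have := subsetP TS x xT; rewrite inE => /andP[xD xS].
  exists x, y; split=> //; rewrite inE yS andbT; apply/negP => yD.
  have xv : x != v by apply: contraNneq vT => <-.
  by have := noedge y x yD xS xD xv; rewrite adj_sym xy.
apply/connP => T T0 TS; have [vT|] := boolP (v \in T); last first.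
  exact: main T0 (proper_sub TS).
have [||| x [y [xT yS yT xy]]] := main (S :\: D :\: T).
- by rewrite setD_eq0; have := TS; rewrite properE => /andP[].
- exact: subsetDl.
- by rewrite inE vT.
move: xT yT; rewrite ![_ \in _ :\: T]in_setD yS andbT negbK => /andP[xT xS] yT.
by exists y, x; rewrite adj_sym.
Qed.

End Connectivity.

(** * Decomposition into bags *)

Section Bags.
Variables (R : realType) (G : sgraph) (s : bool).
Implicit Types (S T A B C D E : {set G}) (x y v w : G).

Definition three_quarters S : R := 3%:R * #|S|%:R / 4%:R.

Lemma certified_partition S (P : {set {set G}}) :
  partition P S -> (1 < #|P|)%N ->
  (forall B, B \in P -> certified s (S :\: B) (three_quarters (S :\: B))) ->
  certified s S (three_quarters S).
Proof.
move=> partP P_gt1 certP; have K_gt0 : 0 < #|P|.-1%:R :> R.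
  by rewrite ltr0n -subn1 subn_gt0.
apply: certified_le (certified_bags partP P_gt1 certP).
have sPS B : B \in P -> B \subset S.
  by move=> BP; rewrite -(cover_partition partP); exact: bigcup_sup.
have card_sum : \sum_(B in P) #|S :\: B|%:R = #|P|.-1%:R * #|S|%:R :> R.
  transitivity (\sum_(B in P) (#|S|%:R - #|B|%:R) : R).
    by apply: eq_bigr => B /sPS BS; rewrite cardsD (setIidPr BS) natrB ?subset_leq_card.
  have KE : #|P|%:R = #|P|.-1%:R + 1 :> R by rewrite natr1 (ltn_predK P_gt1).
  rewrite sumrB sumr_const -natr_sum -(card_partition partP) -[_ *+ #|P|]mulr_natl KE.
  by ring.
rewrite ler_pdivlMr // /three_quarters -mulr_suml -mulr_sumr card_sum.
by rewrite le_eqVlt; apply/orP; left; apply/eqP; ring.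
Qed.

(** The bags B and C are connected and contain v and w.  If B avoids w, it lies
in one component of S \ w, so it is contained in E, hence disjoint from C, or it
is disjoint from E, hence contained in C; the case where C avoids v is
symmetric.  If w is in B and v is in C, then D avoids w and meets E by the
cardinality assumption, so D is contained in E and C in B. *)
Lemma bags_laminar S v w D E (B := S :\: D) (C := S :\: E) :
  conn S -> v \in S -> w \in S ->
  D \in comps (S :\ v) -> E \in comps (S :\ w) -> (#|B| < #|E|)%N ->
  [\/ [disjoint B & C], B \subset C | C \subset B].
Proof.
move=> cS vS wS Dv Ew BE.
have [D0 cD sD] := compsP Dv; have [E0 cE sE] := compsP Ew.
have sDS : D \subset S := subset_trans sD (subsetDl _ _).
have sES : E \subset S := subset_trans sE (subsetDl _ _).
have vD : v \notin D by apply/negP => /(subsetP sD); rewrite !inE eqxx.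
have wE : w \notin E by apply/negP => /(subsetP sE); rewrite !inE eqxx.
have bagE A F z u : F \in comps (S :\ u) -> conn A -> A \subset S -> u \notin A ->
    z \in A -> z \in F -> A \subset F.
  move=> Fu cA sA uA zA zF; apply: (comps_absorb Fu cA _ zA zF); last by rewrite eqxx.
  by rewrite subsetD1 sA.
have cB : conn B by exact: conn_compl cS vS Dv.
have cC : conn C by exact: conn_compl cS wS Ew.
have disjP (A F : {set G}) : (forall z, z \in A -> z \in F -> false) -> [disjoint A & F].
  by move=> AF; apply/pred0Pn => -[z /andP[zA zF]]; have := AF z zA zF.
have [wD|wD] := boolP (w \in D); have [vE|vE] := boolP (v \in E).
- have BsE : B \subset E.
    by apply: (bagE _ _ v w) => //; rewrite ?subsetDl // inE ?wD ?vD ?vS.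
  constructor 1; apply: disjP => z /(subsetP BsE) zE.
  by rewrite inE zE.
- constructor 2; apply/subsetP => z zB; have := zB; rewrite !inE => /andP[_ ->].
  rewrite andbT; apply: contra vE => zE.
  have /subsetP : B \subset E.
    by apply: (bagE _ _ z w) => //; rewrite ?subsetDl // inE ?wD.
  by apply; rewrite inE vD.
- constructor 3; apply/subsetP => z zC; have := zC; rewrite !inE => /andP[_ ->].
  rewrite andbT; apply: contra wD => zD.
  have /subsetP : C \subset D.
    by apply: (bagE _ _ z v) => //; rewrite ?subsetDl // inE ?vE.
  by apply; rewrite inE wE.
constructor 3; apply: setDS.
have /subsetPn[z zE zB] : ~~ (E \subset B).
  by apply: contraTN BE => /subset_leq_card; rewrite -leqNgt.
have zD : z \in D by move: zB; rewrite inE (subsetP sES) // andbT negbK.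
exact: (bagE _ _ z w).
Qed.

(** Every vertex v lies in its bag S \ D, so the maximal bags cover S; by
laminarity they are disjoint. *)
Lemma certified_bag_step S :
  conn S ->
  (forall T, conn T -> (4 <= #|T| < #|S|)%N -> certified s T (three_quarters T)) ->
  S != set0 ->
  (forall v, v \in S -> exists2 D, D \in comps (S :\ v) & (4 <= #|D|)%N) ->
  certified s S (three_quarters S).
Proof.
move=> cS IH S0 bigD.
pose F := [set B : {set G} | [exists v in S, exists D in comps (S :\ v),
                                (4 <= #|D|)%N && (B == S :\: D)]].
have FP B : B \in F -> exists v D,
    [/\ v \in S, D \in comps (S :\ v), (4 <= #|D|)%N & B = S :\: D].
  rewrite inE => /exists_inP[v vS /exists_inP[D Dv /andP[D4 /eqP->]]].
  by exists v, D.
have compE v D : v \in S -> D \in comps (S :\ v) ->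
    [/\ conn D, D \subset S, v \notin D & S :\: (S :\: D) = D].
  move=> vS /compsP[_ cD sD]; have sDS := subset_trans sD (subsetDl _ _).
  split=> //; first by apply/negP => /(subsetP sD); rewrite !inE eqxx.
  by rewrite setDDr setDv set0U (setIidPr sDS).
have ltS v D : v \in S -> v \notin D -> D \subset S -> (#|D| < #|S|)%N.
  move=> vS vD sDS; rewrite proper_card // properE sDS.
  by apply/subsetPn; exists v.
have [bigB|smallB] := boolP [exists B in F, (4 <= #|B|)%N].
  case/exists_inP: bigB => B BF B4; have [v [D [vS Dv D4 defB]]] := FP B BF.
  have [cD sDS vD SDD] := compE v D vS Dv; have D0 : D != set0 by case/compsP: Dv.
  have vB : v \in B by rewrite defB inE vD.
  have disjBD : [disjoint B & D].
    by rewrite defB -setI_eq0 setIDAC setDIl setDv setI0.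
  have BD : B != D by apply: contraNneq vD => <-.
  have sBS : B \subset S by rewrite defB subsetDl.
  apply: (@certified_partition _ [set B; D]) => [||C].
  - apply/and3P; split.
    + by rewrite /cover bigcup_setU !big_set1 defB setUC -{1}(setIidPr sDS) setID.
    + apply/trivIsetP => C E; rewrite !inE => /orP[] /eqP-> /orP[] /eqP->;
      by rewrite ?eqxx // disjoint_sym.
    by rewrite !inE negb_or ![set0 == _]eq_sym D0 andbT; apply/set0Pn; exists v.
  - by rewrite cards2 BD.
  rewrite !inE => /orP[] /eqP->.
    by rewrite defB SDD; apply: IH => //; rewrite D4 (ltS v).
  rewrite -defB; apply: IH; first by rewrite defB (conn_compl cS vS).
  rewrite B4 proper_card // properE sBS; have [d dD] := set0Pn _ D0.
  apply/subsetPn; exists d; first exact: (subsetP sDS).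
  by rewrite defB inE dD.
have {smallB} smallB B : B \in F -> (#|B| < 4)%N.
  move=> BF; rewrite ltnNge; apply: contra smallB => B4.
  by apply/exists_inP; exists B.
have laminar B C : B \in F -> C \in F ->
    [\/ [disjoint B & C], B \subset C | C \subset B].
  move=> BF CF; have [v [D [vS Dv D4 defB]]] := FP B BF.
  have [w [E [wS Ew E4 defC]]] := FP C CF; rewrite defB defC.
  apply: (bags_laminar cS vS wS Dv Ew); rewrite -defB.
  exact: leq_trans (smallB B BF) E4.
pose P := [set B in F | [forall C in F, (B \subset C) ==> (C == B)]].
have PF B : B \in P -> B \in F by rewrite inE => /andP[].
have maxP B C : B \in P -> C \in F -> B \subset C -> C = B.
  by rewrite inE => /andP[_ /forall_inP maxB] /maxB/implyP CB /CB/eqP.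
have coverP x : x \in S -> exists2 B, B \in P & x \in B.
  move=> xS; have [D Dx D4] := bigD x xS; have [_ _ xD _] := compE x D xS Dx.
  have BF : S :\: D \in F.
    rewrite inE; apply/exists_inP; exists x => //.
    by apply/exists_inP; exists D; rewrite ?D4 /=.
  have [B /maxsetP[BF' maxB] sB] := maxset_exists (P := mem F) BF.
  exists B; last by apply: (subsetP sB); rewrite inE xD.
  have {}BF' : B \in F by [].
  rewrite inE BF'; apply/forall_inP => C CF; apply/implyP => BC.
  by apply/eqP/maxB.
have partP : partition P S.
  apply/and3P; split.
  - apply/eqP/setP => x; apply/bigcupP/idP => [[B /PF/FP[v [D [_ _ _ ->]]]]|].
      by rewrite inE => /andP[].
    by case/coverP => B BP xB; exists B.
  - apply/trivIsetP => B C BP CP BC.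
    have [//|/(maxP _ _ BP (PF _ CP))|/(maxP _ _ CP (PF _ BP))] := laminar _ _ (PF _ BP) (PF _ CP).
      by move=> e; rewrite e eqxx in BC.
    by move=> e; rewrite e eqxx in BC.
  apply/negP => /PF/FP[v [D [vS Dv _ def0]]]; have [_ _ vD _] := compE v D vS Dv.
  by have := in_set0 v; rewrite def0 inE vD vS.
have [x xS] := set0Pn _ S0.
apply: (certified_partition partP) => [|B BP].
  have [B BP xB] := coverP x xS; have [v [D [vS Dv D4 defB]]] := FP B (PF _ BP).
  have [_ sDS _ SDD] := compE v D vS Dv.
  have [d dD] : exists d, d \in D by apply/set0Pn; rewrite -card_gt0 (leq_trans _ D4).
  have [C CP dC] := coverP d (subsetP sDS d dD).
  apply/card_gt1P; exists B, C; split=> //; apply: contraTneq dD => BC.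
  by move: dC; rewrite -BC defB inE => /andP[].
have [v [D [vS Dv D4 ->]]] := FP B (PF _ BP).
have [cD sDS vD ->] := compE v D vS Dv.
by apply: IH => //; rewrite D4 (ltS v).
Qed.

End Bags.

(** * Explicit certificates on five to seven vertices *)

Section Small.
Variables (R : realType) (G : sgraph).
Implicit Types (S T A B C D E : {set G}) (x y v w : G).

Definition certifiable s S := certified s S (three_quarters R S).

Lemma certified_check s (x0 : G) (r : seq G) (vs := x0 :: r) (E U : seq (nat * nat))
    (D : Z) (B : seq (seq Z)) :
  uniq vs -> realizes x0 vs E U ->
  check s (size vs) E U D B (3 * Z.of_nat (size vs))%BZ 4%BZ ->
  certifiable s [set x in vs].
Proof.
move=> Uvs real chk; have [X [psdX suppX valX _]] := check_certificate R Uvs real chk.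
exists X; split=> //; apply: le_trans valX.
rewrite /three_quarters cardsE (card_uniqP Uvs); move: (size vs) => n.
rewrite le_eqVlt; apply/orP; left; apply/eqP; congr (_ / _).
by rewrite ZtoRM ZtoR_nat.
Qed.

End Small.

Ltac realize :=
  rewrite /realizes /=;
  repeat match goal with
  | H : is_true (adj ?a ?b) |- context [adj ?a ?b] => rewrite H
  | H : adj ?a ?b = _ |- context [adj ?a ?b] => rewrite H
  | H : is_true (adj ?a ?b) |- context [adj ?b ?a] => rewrite (adj_sym b a) H
  | H : adj ?a ?b = _ |- context [adj ?b ?a] => rewrite (adj_sym b a) H
  end; done.

(** The list of vertices and their adjacencies are looked up in the hypotheses. *)
Tactic Notation "certify" uconstr(E) uconstr(U) uconstr(D) uconstr(B) :=
  lazymatch goal with H : is_true (uniq (?x0 :: ?r)) |- _ =>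
    refine (@certified_check _ _ _ x0 r E U D B H _ _); [realize | by []]
  end.

Section SmallGraphs.
Variables (R : realType) (G : sgraph).
Implicit Types (x y v w : G).
Local Notation "a ~~ b" := (is_true (adj a b)) (at level 70).
Local Notation "a /~ b" := (adj a b = false) (at level 70).

(** In this part, each lemma concerns graphs with a cut vertex v whose removal
leaves two components.  Pairs of vertices that the hypotheses do not mention may
or may not be adjacent; one certificate serves both possibilities, unless a case
distinction on such a pair is made in the proof.  The names describe a spanning
tree (a fork is a path with a claw at one end), except for the bowtie.

The integer matrices approximate a multiple of the positive part of +-A, where
undecided pairs have received their least favourable weights between 0 and 1. *)
Lemma certifiable_path5 s (w v x y z : G) : uniq [:: w; v; x; y; z] ->
  [/\ w ~~ v, v ~~ x, x ~~ y & y ~~ z] -> [/\ w /~ x, w /~ y & w /~ z] ->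
  certifiable R s [set u in [:: w; v; x; y; z]].
Proof.
move=> Uvs [wv vx xy yz] [wx wy wz]; case: s; last first.
  certify [:: (0, 1); (1, 2); (2, 3); (3, 4)] [:: (1, 3); (1, 4); (2, 4)]
    12%BZ [:: [:: -1; 0; 2; 3; 2]; [:: -2; -3; -2; -1; 0]]%BZ.
case xz: (adj x z).
  certify [:: (0, 1); (1, 2); (2, 3); (3, 4); (2, 4)] [:: (1, 3); (1, 4)]
    689%BZ [:: [:: -3; -2; 20; -7; -14]; [:: 17; -21; 9; 7; -4]; [:: 5; -7; 7; -19; 16]]%BZ.
certify [:: (0, 1); (1, 2); (2, 3); (3, 4)] [:: (1, 3); (1, 4)]
    12%BZ [:: [:: -2; 3; -2; 0; 0]; [:: 0; 0; -2; 3; -2]]%BZ.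
Qed.

Lemma certifiable_fork5 s (w v y x z : G) : uniq [:: w; v; y; x; z] ->
  [/\ w ~~ v, v ~~ y, y ~~ x & y ~~ z] ->
  [/\ w /~ y, w /~ x & w /~ z] -> [/\ v /~ x, v /~ z & x /~ z] ->
  certifiable R s [set u in [:: w; v; y; x; z]].
Proof.
move=> Uvs [wv vy yx yz] [wy wx wz] [vx vz xz]; case: s.
  certify [:: (0, 1); (1, 2); (2, 3); (2, 4)] [::]
    6%BZ [:: [:: 1; -2; 2; -1; -1]; [:: 1; -1; -1; 1; 1]]%BZ.
certify [:: (0, 1); (1, 2); (2, 3); (2, 4)] [::]
    6%BZ [:: [:: 1; 2; 2; 1; 1]; [:: -1; -1; 1; 1; 1]]%BZ.
Qed.

Lemma certifiable_bowtie s (b a v c d : G) : uniq [:: b; a; v; c; d] ->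
  [/\ b ~~ a, a ~~ v & b ~~ v] -> [/\ v ~~ c, c ~~ d & v ~~ d] ->
  [/\ b /~ c, b /~ d, a /~ c & a /~ d] ->
  certifiable R s [set u in [:: b; a; v; c; d]].
Proof.
move=> Uvs [ba av bv] [vc cd vd] [bc bd ac ad]; case: s.
  certify [:: (0, 1); (1, 2); (2, 3); (3, 4); (0, 2); (2, 4)] [::]
    3%BZ [:: [:: 1; -1; 0; 1; -1]; [:: -1; 0; 1; 0; -1]; [:: 0; -1; 1; -1; 0]]%BZ.
certify [:: (0, 1); (1, 2); (2, 3); (3, 4); (0, 2); (2, 4)] [::]
    1%BZ [:: [:: 0; 0; 1; 1; 1]; [:: -1; -1; -1; 0; 0]]%BZ.
Qed.

Lemma certifiable_path6 s (b a v x y z : G) : uniq [:: b; a; v; x; y; z] ->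
  [/\ b ~~ a & a ~~ v] -> [/\ v ~~ x, x ~~ y & y ~~ z] ->
  [/\ b /~ x, b /~ y & b /~ z] -> [/\ a /~ x, a /~ y & a /~ z] ->
  certifiable R s [set u in [:: b; a; v; x; y; z]].
Proof.
move=> Uvs [ba av] [vx xy yz] [bx b_y bz] [ax ay az]; case: s; last first.
  certify [:: (0, 1); (1, 2); (2, 3); (3, 4); (4, 5)] [:: (0, 2); (2, 4); (2, 5); (3, 5)]
    7%BZ [:: [:: 1; 2; 2; 1; 1; 1]; [:: -1; -1; 0; 1; 2; 1]; [:: 0; 0; -1; -1; 0; 1]]%BZ.
case xz: (adj x z); last first.
  certify [:: (0, 1); (1, 2); (2, 3); (3, 4); (4, 5)] [:: (0, 2); (2, 4); (2, 5)]
    13%BZ [:: [:: 1; -1; 0; 2; -3; 2]; [:: -2; 2; 0; 0; -1; 1]; [:: 0; -2; 3; -2; 0; 0]]%BZ.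
case bv: (adj b v).
  certify [:: (0, 1); (1, 2); (2, 3); (3, 4); (4, 5); (3, 5); (0, 2)] [:: (2, 4); (2, 5)]
    6%BZ [:: [:: 0; 0; 0; -1; -1; 2]; [:: -1; -1; 2; -1; 0; 0]; [:: 1; -1; 0; 1; -1; 0]; [:: -1; 1; 0; 1; -1; 0]]%BZ.
certify [:: (0, 1); (1, 2); (2, 3); (3, 4); (4, 5); (3, 5)] [:: (2, 4); (2, 5)]
    13%BZ [:: [:: 0; 0; 0; -2; 0; 2]; [:: -2; 3; -2; 0; 1; 0]; [:: 0; -1; 2; -2; 2; -1]; [:: -1; 0; 1; -1; -2; 2]]%BZ.
Qed.

Lemma certifiable_fork6 s (b a v y x z : G) : uniq [:: b; a; v; y; x; z] ->
  [/\ b ~~ a & a ~~ v] -> [/\ v ~~ y, y ~~ x & y ~~ z] ->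
  [/\ b /~ y, b /~ x & b /~ z] -> [/\ a /~ y, a /~ x & a /~ z] ->
  [/\ v /~ x, v /~ z & x /~ z] ->
  certifiable R s [set u in [:: b; a; v; y; x; z]].
Proof.
move=> Uvs [ba av] [vy yx yz] [b_y bx bz] [ay ax az] [vx vz xz]; case: s.
  certify [:: (0, 1); (1, 2); (2, 3); (3, 4); (3, 5)] [:: (0, 2)]
    9%BZ [:: [:: 2; -1; -1; 2; -1; -1]; [:: 0; 1; -1; -1; 1; 1]; [:: -1; 2; -2; 2; -1; -1]]%BZ.
certify [:: (0, 1); (1, 2); (2, 3); (3, 4); (3, 5)] [:: (0, 2)]
    4%BZ [:: [:: 0; 0; 1; 2; 1; 1]; [:: -1; -2; -1; 0; 0; 0]]%BZ.
Qed.

Lemma certifiable_path7 s (t u w v x y z : G) : uniq [:: t; u; w; v; x; y; z] ->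
  [/\ t ~~ u, u ~~ w & w ~~ v] -> [/\ v ~~ x, x ~~ y & y ~~ z] ->
  [/\ t /~ x, t /~ y & t /~ z] -> [/\ u /~ x, u /~ y & u /~ z] ->
  [/\ w /~ x, w /~ y & w /~ z] ->
  certifiable R s [set k in [:: t; u; w; v; x; y; z]].
Proof.
move=> Uvs [tu uw wv] [vx xy yz] [tx ty tz] [ux uy uz] [wx wy wz].
case: s; last first.
  certify [:: (0, 1); (1, 2); (2, 3); (3, 4); (4, 5); (5, 6)] [:: (1, 3); (0, 3); (0, 2); (3, 5); (3, 6); (4, 6)]
    4%BZ [:: [:: 1; 1; 1; 1; 1; 1; 1]; [:: -1; -1; 0; 1; 1; 1; 0]; [:: 0; -1; -1; -1; 0; 1; 1]]%BZ.
case xz: (adj x z); case tw: (adj t w).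
- certify [:: (0, 1); (1, 2); (2, 3); (3, 4); (4, 5); (5, 6); (0, 2); (4, 6)] [:: (1, 3); (0, 3); (3, 5); (3, 6)]
    35%BZ [:: [:: -3; 3; 1; -1; -2; 3; 0]; [:: 1; 1; -4; 4; -2; 2; -2]; [:: 0; 0; -1; 2; -3; -2; 4]; [:: 2; 2; -3; -2; 2; -1; 0]; [:: -3; 3; -1; 1; 2; -3; 0]]%BZ.
- certify [:: (0, 1); (1, 2); (2, 3); (3, 4); (4, 5); (5, 6); (4, 6)] [:: (1, 3); (0, 3); (3, 5); (3, 6)]
    11%BZ [:: [:: -1; 1; -1; 0; 2; -2; 0]; [:: 0; 0; 1; -2; 2; 1; -2]; [:: -2; 2; -1; 0; -1; 1; 0]; [:: 0; 0; 2; -2; 0; -1; 2]]%BZ.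
- have -> : [set k in [:: t; u; w; v; x; y; z]]
            = [set k in [:: z; y; x; v; w; u; t]].
    by apply/setP => k; rewrite [LHS]inE [RHS]inE -mem_rev.
  have {}Uvs : uniq [:: z; y; x; v; w; u; t] by rewrite -rev_uniq.
  certify [:: (0, 1); (1, 2); (2, 3); (3, 4); (4, 5); (5, 6); (4, 6)] [:: (1, 3); (0, 3); (3, 5); (3, 6)]
    11%BZ [:: [:: -1; 1; -1; 0; 2; -2; 0]; [:: 0; 0; 1; -2; 2; 1; -2]; [:: -2; 2; -1; 0; -1; 1; 0]; [:: 0; 0; 2; -2; 0; -1; 2]]%BZ.
certify [:: (0, 1); (1, 2); (2, 3); (3, 4); (4, 5); (5, 6)] [:: (1, 3); (0, 3); (3, 5); (3, 6)]
    11%BZ [:: [:: 0; 0; -2; 3; -2; 0; 0]; [:: 0; 0; 0; 0; -2; 3; -2]; [:: -2; 3; -2; 0; 0; 0; 0]]%BZ.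
Qed.

Lemma certifiable_clawpath7 s (l m c v x y z : G) : uniq [:: l; m; c; v; x; y; z] ->
  [/\ l ~~ c, m ~~ c & c ~~ v] -> [/\ v ~~ x, x ~~ y & y ~~ z] ->
  [/\ l /~ m, l /~ v & m /~ v] ->
  [/\ l /~ x, l /~ y & l /~ z] -> [/\ m /~ x, m /~ y & m /~ z] ->
  [/\ c /~ x, c /~ y & c /~ z] ->
  certifiable R s [set k in [:: l; m; c; v; x; y; z]].
Proof.
move=> Uvs [lc mc cv] [vx xy yz] [lm lv mv] [lx ly lz] [mx my mz] [cx cy cz].
case: s.
  certify [:: (0, 2); (1, 2); (2, 3); (3, 4); (4, 5); (5, 6)] [:: (3, 5); (3, 6); (4, 6)]
    22%BZ [:: [:: -2; -2; 4; -3; 1; 0; 1]; [:: 0; 0; 0; 0; -2; 4; -2]; [:: 0; 0; 1; -2; 3; 0; -2]; [:: 2; 2; -2; -1; 1; 0; 1]]%BZ.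
certify [:: (0, 2); (1, 2); (2, 3); (3, 4); (4, 5); (5, 6)] [:: (3, 5); (3, 6); (4, 6)]
    6%BZ [:: [:: 1; 1; 2; 2; 1; 1; 1]; [:: -1; -1; -1; 0; 1; 2; 1]; [:: 0; 0; 0; -1; -1; 0; 1]]%BZ.
Qed.

Lemma certifiable_clawclaw7 s (l m c v y x z : G) : uniq [:: l; m; c; v; y; x; z] ->
  [/\ l ~~ c, m ~~ c & c ~~ v] -> [/\ v ~~ y, y ~~ x & y ~~ z] ->
  [/\ l /~ m, l /~ v & m /~ v] -> [/\ x /~ z, v /~ x & v /~ z] ->
  [/\ l /~ y, l /~ x & l /~ z] -> [/\ m /~ y, m /~ x & m /~ z] ->
  [/\ c /~ y, c /~ x & c /~ z] ->
  certifiable R s [set k in [:: l; m; c; v; y; x; z]].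
Proof.
move=> Uvs [lc mc cv] [vy yx yz] [lm lv mv] [xz vx vz] [ly lx lz] [my mx mz].
move=> [cy cx cz]; case: s.
  certify [:: (0, 2); (1, 2); (2, 3); (3, 4); (4, 5); (4, 6)] [::]
    4%BZ [:: [:: 0; 0; 0; 1; -2; 1; 1]; [:: -1; -1; 2; -1; 0; 0; 0]]%BZ.
certify [:: (0, 2); (1, 2); (2, 3); (3, 4); (4, 5); (4, 6)] [::]
    4%BZ [:: [:: 0; 0; 0; 1; 2; 1; 1]; [:: -1; -1; -2; -1; 0; 0; 0]]%BZ.
Qed.

End SmallGraphs.

(** * Four vertices *)

Section FourVertices.
Variables (R : realType) (G : sgraph).
Implicit Types (S T A B C D E : {set G}) (x y v w : G).
Local Notation "a ~~ b" := (is_true (adj a b)) (at level 70).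
Local Notation "a /~ b" := (adj a b = false) (at level 70).

Lemma certified_list (s : bool) (x0 : G) (r : seq G) (vs := x0 :: r) (B : seq (seq R)) (a : R)
    (g := fun i j => a * \sum_(y <- B) y`_i * y`_j) :
  uniq vs -> all (fun y : seq R => size y <= size vs)%N B -> 0 <= a ->
  3%:R * (size vs)%:R / 4%:R <= \sum_(0 <= i < size vs) \sum_(0 <= j < size vs)
       (2%:R * ((-1) ^+ s * adjf R (nth x0 vs i) (nth x0 vs j) * g i j)
        - g i j ^+ 2) ->
  certifiable R s [set x in vs].
Proof.
move=> Uvs sB a0 le_val; exists (list_gram vs B a); split.
- exact: psd_list_gram.
- exact: supported_list_gram.
by rewrite (@value_list_gram _ _ s x0) // /three_quarters cardsE (card_uniqP Uvs).
Qed.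

(** The value of the certificate is exactly 3 and irrational entries cannot be
avoided: it is the positive (or negative) part of the adjacency matrix of the
path.  Its entry at (a, d) vanishes and, for the positive sign, its entries at
(a, c) and (b, d) are positive, so chords do no harm there. *)
Lemma certifiable_path4_sqrt (s : bool) (a b c d : G) : uniq [:: a; b; c; d] ->
  [/\ a ~~ b, b ~~ c & c ~~ d] -> (s -> a /~ c /\ b /~ d) ->
  certifiable R s [set u in [:: a; b; c; d]].
Proof.
move=> Uvs [ab bc cd] chords; set q : R := Num.sqrt 5%:R.
have q0 : 0 <= q by exact: sqrtr_ge0.
have q2 : q ^+ 2 = 5%:R by rewrite sqr_sqrtr ?ler0n.
have q4 : q ^+ 4 = 25%:R by rewrite (exprM q 2 2) q2; ring.
have q6 : q ^+ 6 = 125%:R by rewrite (exprM q 2 3) q2; ring.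
pose e : R := (-1) ^+ s.
refine (@certified_list s a [:: b; c; d]
  [:: [:: 2%:R; e * q; 1; 0]; [:: 0; e; q; 2%:R * e]] (q / 20%:R) Uvs _ _ _) => //.
  by rewrite divr_ge0 ?ler0n.
rewrite -/e /index_iota /= !big_cons !big_nil /= /adjf !adj_irrefl.
rewrite !(adj_sym b a) !(adj_sym c a) !(adj_sym c b) !(adj_sym d) ab bc cd.
rewrite {}/e; case: s chords => [/(_ isT)[-> ->]|_]; rewrite ?expr1 ?expr0.
  by case: (adj a d); rewrite ?mulr1n ?mulr0n; lra.
by case: (adj a d); case: (adj a c); case: (adj b d); rewrite ?mulr1n ?mulr0n; lra.
Qed.

(** As for the path the bound is attained, by the rank-one positive (or negative)
part of the adjacency matrix, with eigenvalue +- sqrt 3. *)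
Lemma certifiable_claw4 (s : bool) (o a b c : G) : uniq [:: o; a; b; c] ->
  [/\ o ~~ a, o ~~ b & o ~~ c] -> [/\ a /~ b, a /~ c & b /~ c] ->
  certifiable R s [set u in [:: o; a; b; c]].
Proof.
move=> Uvs [oa ob oc] [ab ac bc]; set q : R := Num.sqrt 3%:R.
have q0 : 0 <= q by exact: sqrtr_ge0.
have q2 : q ^+ 2 = 3%:R by rewrite sqr_sqrtr ?ler0n.
have q4 : q ^+ 4 = 9%:R by rewrite (exprM q 2 2) q2; ring.
have q6 : q ^+ 6 = 27%:R by rewrite (exprM q 2 3) q2; ring.
pose e : R := (-1) ^+ s.
refine (@certified_list s o [:: a; b; c]
  [:: [:: e * q; 1; 1; 1]] (q / 6%:R) Uvs _ _ _) => //.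
  by rewrite divr_ge0 ?ler0n.
rewrite -/e /index_iota /= !big_cons !big_nil /= /adjf !adj_irrefl.
rewrite !(adj_sym a o) !(adj_sym b o) !(adj_sym c o) oa ob oc.
rewrite !(adj_sym b a) !(adj_sym c) ab ac bc {}/e.
by case: s; rewrite ?expr1 ?expr0 ?mulr1n ?mulr0n; lra.
Qed.

Lemma certifiable_path4 (s : bool) (a b c d : G) : uniq [:: a; b; c; d] ->
  [/\ a ~~ b, b ~~ c & c ~~ d] -> certifiable R s [set u in [:: a; b; c; d]].
Proof.
move=> Uvs [ab bc cd]; case: s; last by apply: certifiable_path4_sqrt.
case ac: (adj a c); case bd: (adj b d); last by apply: certifiable_path4_sqrt.
- case ad: (adj a d).
    certify [:: (0, 1); (1, 2); (2, 3); (0, 2); (1, 3); (0, 3)] [::]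
    4%BZ [:: [:: -1; 1; 1; -1]; [:: 1; -1; 1; -1]; [:: 1; 1; -1; -1]]%BZ.
  certify [:: (0, 1); (1, 2); (2, 3); (0, 2); (1, 3)] [::]
    2%BZ [:: [:: 1; -1; -1; 1]; [:: 0; -1; 1; 0]]%BZ.
- case ad: (adj a d).
    certify [:: (0, 1); (1, 2); (2, 3); (0, 2); (0, 3)] [::]
    2%BZ [:: [:: 1; -1; 1; -1]; [:: -1; 0; 1; 0]]%BZ.
  certify [:: (0, 1); (1, 2); (2, 3); (0, 2)] [::]
    6%BZ [:: [:: -1; 2; -1; 1]; [:: 2; 0; -2; 1]]%BZ.
have -> : [set u in [:: a; b; c; d]] = [set u in [:: d; c; b; a]].
  by apply/setP => k; rewrite [LHS]inE [RHS]inE -mem_rev.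
have {}Uvs : uniq [:: d; c; b; a] by rewrite -rev_uniq.
case ad: (adj a d).
  certify [:: (0, 1); (1, 2); (2, 3); (0, 2); (0, 3)] [::]
    2%BZ [:: [:: 1; -1; 1; -1]; [:: -1; 0; 1; 0]]%BZ.
certify [:: (0, 1); (1, 2); (2, 3); (0, 2)] [::]
    6%BZ [:: [:: -1; 2; -1; 1]; [:: 2; 0; -2; 1]]%BZ.
Qed.
End FourVertices.

(** * Listing the vertices of small connected sets *)

Section ConnectedLists.
Variables (R : realType) (G : sgraph).
Implicit Types (S T A B C D E : {set G}) (x y v w : G).
Local Notation "a ~~ b" := (is_true (adj a b)) (at level 70).
Local Notation "a /~ b" := (adj a b = false) (at level 70).

Lemma adj_neq x y : x ~~ y -> x != y.
Proof. by apply: contraTneq => ->; rewrite adj_irrefl. Qed.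

Lemma eq_list_set (D : {set G}) (r : seq G) : uniq r -> {subset r <= D} ->
  #|D| = size r -> D = [set u in r].
Proof.
move=> Ur rD cardD; apply/esym/eqP; rewrite eqEcard cardD cardsE (card_uniqP Ur).
by rewrite leqnn andbT; apply/subsetP => u; rewrite inE => /rD.
Qed.

Lemma conn_grow D (r : seq G) : conn D -> uniq r -> {subset r <= D} ->
  (0 < size r < #|D|)%N ->
  exists x y, [/\ x \in r, y \in D, y \notin r & x ~~ y].
Proof.
move=> /connP cD Ur rD /andP[r_gt0 r_lt].
have cardr : #|[set u in r]| = size r by rewrite cardsE (card_uniqP Ur).
have [||x [y [xr yD yr xy]]] := cD [set u in r].
- by rewrite -card_gt0 cardr.
- rewrite properEcard cardr r_lt andbT.
  by apply/subsetP => u; rewrite inE => /rD.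
by exists x, y; move: xr yr; rewrite !inE.
Qed.

Lemma conn_pair D a : conn D -> #|D| = 2%N -> a \in D ->
  exists2 b, a ~~ b & D = [set u in [:: a; b]].
Proof.
move=> cD cardD aD; have [//|||x [b [+ bD ba ab]]] := conn_grow cD (r := [:: a]).
- by move=> u; rewrite inE => /eqP->.
- by rewrite cardD.
rewrite !inE in ba *; move=> /eqP xa; rewrite {x}xa in ab; exists b => //.
apply: eq_list_set => //=; first by rewrite inE eq_sym ba.
by move=> u; rewrite !inE => /orP[] /eqP->.
Qed.

Lemma conn_triple D a : conn D -> #|D| = 3%N -> a \in D ->
  exists b c, [/\ uniq [:: a; b; c], D = [set u in [:: a; b; c]], a ~~ b
     & a ~~ c \/ b ~~ c].
Proof.
move=> cD cardD aD; have [//|||x [b [+ bD ba ab]]] := conn_grow cD (r := [:: a]).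
- by move=> u; rewrite inE => /eqP->.
- by rewrite cardD.
rewrite !inE in ba *; move=> /eqP xa; rewrite {x}xa in ab.
have Uab : uniq [:: a; b] by rewrite /= inE eq_sym ba.
have sab : {subset [:: a; b] <= D} by move=> u; rewrite !inE => /orP[] /eqP->.
have [|x [c [xab cD' cab xc]]] := conn_grow cD Uab sab; first by rewrite cardD.
have Uabc : uniq [:: a; b; c].
  by rewrite -[uniq _]/(uniq (rcons [:: a; b] c)) rcons_uniq cab.
exists b, c; split=> //.
  apply: eq_list_set => // u; rewrite -[_ \in _]/(u \in rcons [:: a; b] c).
  by rewrite mem_rcons inE => /orP[/eqP->|/sab].
by move: xab; rewrite !inE => /orP[] /eqP <-; [left | right].
Qed.

(** The two shapes of a connected triple D attached to v: a path that starts at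
a neighbour of v (with possible further edges), or a claw induced on v and D
whose centre is the neighbour of v. *)
Variant triple_at v D : Prop :=
| TriplePath x y z of uniq [:: x; y; z] & D = [set u in [:: x; y; z]]
    & v ~~ x & x ~~ y & y ~~ z
| TripleClaw x y z of uniq [:: y; x; z] & D = [set u in [:: y; x; z]]
    & v ~~ y & y ~~ x & y ~~ z & v /~ x & v /~ z & x /~ z.

Lemma triple_atP v D a : conn D -> #|D| = 3%N -> a \in D -> v ~~ a ->
  triple_at v D.
Proof.
move=> cD cardD aD va; have [b [c [Uabc defD ab [ac|bc]]]] := conn_triple cD cardD aD;
  last exact: (TriplePath Uabc defD).
have permD r : perm_eq [:: a; b; c] r -> uniq r /\ D = [set u in r].
  move=> pr; rewrite -(perm_uniq pr); split=> //.
  by rewrite defD; apply/setP => u; rewrite [LHS]inE [RHS]inE (perm_mem pr).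
have [bc|bc] := boolP (adj b c); first exact: (TriplePath Uabc defD).
have [vb|vb] := boolP (adj v b).
  have [|U ?] := permD [:: b; a; c]; last by apply: (TriplePath U); rewrite // adj_sym.
  by apply/permP => p /=; ring.
have [vc|vc] := boolP (adj v c).
  have [|U ?] := permD [:: c; a; b]; last by apply: (TriplePath U); rewrite // adj_sym.
  by apply/permP => p /=; ring.
by apply: (TripleClaw Uabc defD) => //; apply: negbTE.
Qed.

Lemma certifiable_four (s : bool) S : conn S -> #|S| = 4%N -> certifiable R s S.
Proof.
move=> cS cardS; have /set0Pn[a aS] : S != set0 by rewrite -card_gt0 cardS.
have [//|||a' [b [+ bS ba ab]]] := conn_grow cS (r := [:: a]).
- by move=> u; rewrite inE => /eqP->.
- by rewrite cardS.
rewrite !inE in ba *; move=> /eqP xa; rewrite {a'}xa in ab.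
have Uab : uniq [:: a; b] by rewrite /= inE eq_sym ba.
have sab : {subset [:: a; b] <= S} by move=> u; rewrite !inE => /orP[] /eqP->.
have [|t [c [tab cS' cab tc]]] := conn_grow cS Uab sab; first by rewrite cardS.
have [x [y [z [Uxyz sxyz xy yz]]]] : exists x y z,
    [/\ uniq [:: x; y; z], {subset [:: x; y; z] <= S}, x ~~ y & y ~~ z].
  move: cab tab; rewrite !inE negb_or => /andP[ca cb] /orP[] /eqP t_eq; rewrite t_eq in tc.
    exists b, a, c; rewrite /= !inE negb_or !(eq_sym _ c) ca cb ba; split=> //.
      by move=> u; rewrite !inE => /or3P[] /eqP->.
    by rewrite adj_sym.
  exists a, b, c; rewrite /= !inE negb_or !(eq_sym _ c) ca cb eq_sym ba; split=> //.
  by move=> u; rewrite !inE => /or3P[] /eqP->.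
have [|t' [d [txyz dS dxyz td]]] := conn_grow cS Uxyz sxyz; first by rewrite cardS.
have mainS r : perm_eq [:: d; x; y; z] r -> uniq r /\ S = [set u in r].
  have U : uniq [:: d; x; y; z] by rewrite cons_uniq dxyz.
  move=> pr; rewrite -(perm_uniq pr); split=> //.
  apply: eq_list_set; rewrite -?(perm_uniq pr) -?(perm_size pr) //.
  by move=> u; rewrite -(perm_mem pr) inE => /orP[/eqP->|/sxyz].
have dpath : d ~~ x -> certifiable R s S.
  by move=> dx; have [//|U ->] := mainS [:: d; x; y; z]; apply: certifiable_path4.
have pathd : z ~~ d -> certifiable R s S.
  move=> zd; have [|U ->] := mainS [:: x; y; z; d]; last by apply: certifiable_path4.
  by apply/permP => p /=; ring.
move: txyz td; rewrite !inE => /or3P[] /eqP-> td; [ | | exact: pathd].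
  by apply: dpath; rewrite adj_sym.
have [dx|dx] := boolP (adj d x); first exact: dpath.
have [zd|zd] := boolP (adj z d); first exact: pathd.
have [xz|xz] := boolP (adj x z).
  have [|U ->] := mainS [:: d; y; x; z].
    by apply/permP => p /=; ring.
  by apply: certifiable_path4; rewrite // adj_sym td adj_sym xy.
have [|U ->] := mainS [:: y; d; x; z].
  by apply/permP => p /=; ring.
apply: certifiable_claw4; rewrite // ?td ?yz; first by rewrite adj_sym.
by split; apply: negbTE; rewrite // adj_sym.
Qed.

End ConnectedLists.

(** * A hub with small components *)

Section Hub.
Variables (R : realType) (G : sgraph).
Implicit Types (S T A B C D E : {set G}) (x y v w : G).
Local Notation "a ~~ b" := (is_true (adj a b)) (at level 70).
Local Notation "a /~ b" := (adj a b = false) (at level 70).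

(** Lower bound for the value and upper bound for the diagonal entries of a
certificate on a component with k vertices.  On a path with three vertices the
optimal value is 2, with irrational entries and sqrt 2 / 2 on the diagonal; a
slightly smaller value allows rational and smaller diagonal entries. *)
Definition block_value (k : nat) : R :=
  if k == 1%N then 0 else if k == 2%N then 1 else 19%:R / 10%:R.
Definition block_diag (k : nat) : R :=
  if k == 1%N then 0 else if k == 2%N then 1 / 2%:R else 2%:R / 3%:R.

Definition block_certificate (s : bool) D := exists X : G -> G -> R,
  [/\ psd X, supported D X, block_value #|D| <= value s X
    & forall u, u \in D -> X u u <= block_diag #|D|].

Lemma block_of_check (s : bool) (x0 : G) (r : seq G) (vs := x0 :: r)
    (E U : seq (nat * nat)) (D : Z) (B : seq (seq Z)) (p q d e : nat) :
  uniq vs -> realizes x0 vs E U ->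
  check s (size vs) E U D B (Z.of_nat p) (Z.of_nat q) ->
  all (fun i => Z.leb (zgram B i i * Z.of_nat e) (Z.of_nat d * D))%BZ
    (iota 0 (size vs)) ->
  block_value (size vs) = p%:R / q%:R -> block_diag (size vs) = d%:R / e%:R ->
  (0 < e)%N -> block_certificate s [set u in vs].
Proof.
move=> Uvs real chk /allP diag val_pq diag_de e_gt0.
have [X [psdX suppX valX dX]] := check_certificate R Uvs real chk.
exists X; split=> //; rewrite cardsE (card_uniqP Uvs).
  by rewrite val_pq -!ZtoR_nat.
move=> u; rewrite inE => uvs; rewrite -(nth_index x0 uvs) dX ?index_mem //.
have D_gt0 : 0 < ZtoR R D.
  by apply: ZtoR_gt0; apply/Z.ltb_lt; case/and4P: chk.
have := diag (index u vs); rewrite mem_iota index_mem => /(_ uvs).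
move=> /Z.leb_le/(ZtoR_le R); rewrite !ZtoRM !ZtoR_nat.
by rewrite diag_de ler_pdivrMr // mulrAC ler_pdivlMr ?ltr0n.
Qed.

Lemma has_block_certificate (s : bool) D : conn D -> (0 < #|D| <= 3)%N ->
  block_certificate s D.
Proof.
move=> cD /andP[D_gt0]; have /set0Pn[a aD] : D != set0 by rewrite -card_gt0.
case cardD: #|D| D_gt0 => [|[|[|[|//]]]] // _ _.
- exists (fun _ _ => 0); rewrite cardD; split=> //; first exact: psd0.
  rewrite /value /frob !big1 ?subr0 ?mulr0 // => u _; rewrite big1 // => v _;
  by rewrite ?mulr0.
- have [b ab defD] := conn_pair cD cardD aD.
  have Uvs : uniq [:: a; b] by rewrite /= inE adj_neq.
  rewrite defD; pose b1 := (if s then -1 else 1)%BZ.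
  apply: (@block_of_check s a [:: b] [:: (0, 1)%N] [::] 2%BZ [:: [:: 1%BZ; b1]] 1 1 1 2 Uvs)%N => //.
  + by realize.
  + by rewrite /b1; case: (s).
  + by rewrite /b1; case: (s).
  + by rewrite /block_value /= divr1.
have [x [y [z [Uvs defD xy yz]]]] : exists x y z,
    [/\ uniq [:: x; y; z], D = [set u in [:: x; y; z]], x ~~ y & y ~~ z].
  have [b [c [U defD ab [ac|bc]]]] := conn_triple cD cardD aD; last by exists a, b, c.
  exists b, a, c; split=> //; last by rewrite adj_sym.
    by rewrite -(perm_uniq (s1 := [:: a; b; c])) //; apply/permP => p /=; ring.
  by rewrite defD; apply/setP => u; rewrite !inE orbCA.
rewrite defD; case xz: (s && adj x z).
  have [-> xz'] := andP xz.
  apply: (@block_of_check _ x [:: y; z] [:: (0, 1); (1, 2); (0, 2)]%N [::] 3%BZ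
    [:: [:: 1; -1; 0]; [:: 0; 1; -1]; [:: 1; 0; -1]]%BZ 19 10 2 3 Uvs)%N => //.
  by realize.
pose b1 := (if s then -4 else 4)%BZ.
apply: (@block_of_check s x [:: y; z] [:: (0, 1); (1, 2)]%N
  (if s then [::] else [:: (0, 2)%N]) 24%BZ [:: [:: 3%BZ; b1; 3%BZ]] 19 10 2 3 Uvs)%N => //.
- by case: (s) xz => /= xz; realize.
- by rewrite /b1; case: (s).
by rewrite /b1; case: (s).
Qed.

Section AtHub.
Variables (s : bool) (S : {set G}) (v : G).
Hypotheses (cS : conn S) (vS : v \in S) (S_ge5 : (5 <= #|S|)%N).
Local Notation P := (comps (S :\ v)).
Hypothesis small : forall D, D \in P -> (#|D| <= 3)%N.

Let size_comp D : D \in P -> (0 < #|D| <= 3)%N.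
Proof. by move=> DP; rewrite small // andbT card_gt0; case/compsP: DP. Qed.

Let sum_sizes : (\sum_(D in P) #|D|)%N = #|S|.-1.
Proof.
rewrite (eqP (comps_trivIset (S :\ v))) cover_comps.
by rewrite (cardsD1 v S) vS.
Qed.

Lemma hub_star (r c : R) (b : nat -> R) : 0 <= c ->
  certified s S (\sum_(C in P) block_value #|C|
     + 2%:R * c * (2%:R * r * (\sum_(C in P) b #|C|)
                   - \sum_(C in P) b #|C| ^+ 2 * block_diag #|C|)
     - c ^+ 2 * (r ^+ 2 + \sum_(C in P) b #|C| ^+ 2) ^+ 2).
Proof.
move=> c_ge0; have defS : v |: cover P = S by rewrite cover_comps setD1K.
rewrite -[X in certified _ X _]defS.
apply: (@certified_star _ _ _ _ _ (fun C => block_value #|C|)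
          (fun C => block_diag #|C|) (fun C => b #|C|)) => //.
- exact: comps_trivIset.
- by rewrite cover_comps !inE eqxx.
- move=> C D x y CP DP CD xC yD; apply: contra CD => xy.
  by apply/eqP/(comps_eq CP DP xC yD); rewrite xy orbT.
move=> C CP; have [a aC va] := comps_edge cS vS CP.
have [_ cC _] := compsP CP.
have [X [psdX suppX valX dX]] := has_block_certificate s cC (size_comp CP).
by exists a, X; split=> //; split=> //; apply: dX.
Qed.

(** Here r = sqrt k for the number k of components, all b are 1 and
c = 1 / (2 sqrt k).  Then each component C contributes
block_value - block_diag / sqrt k + 1, which exceeds 3 |C| / 4 by at least 1 / 4
because sqrt k >= 2; the excesses pay for the 3 / 4 required by the hub. *)
Lemma certifiable_hub4 : (4 <= #|P|)%N -> certifiable R s S.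
Proof.
move=> k_ge4; set k : R := #|P|%:R; pose q := Num.sqrt k.
have q2 : q ^+ 2 = k by rewrite sqr_sqrtr ?ler0n.
have k4 : 4%:R <= k by rewrite ler_nat.
have q_ge2 : 2%:R <= q.
  by rewrite -(@ler_pXn2r _ 2) ?nnegrE ?sqrtr_ge0 ?ler0n // q2 -natrX.
pose i := q^-1; have iq : i * q = 1 by rewrite mulVf // gt_eqF; lra.
have i_ge0 : 0 <= i by rewrite invr_ge0; lra.
have i_le : i <= 1 / 2%:R by nra.
have c_ge0 : 0 <= i / 2%:R by lra.
apply: certified_le (hub_star q (fun=> 1) c_ge0).
have -> : \sum_(C in P) 1 = k :> R by rewrite sumr_const.
have -> : \sum_(C in P) 1 ^+ 2 = k :> R.
  by rewrite -[RHS]sumr_const; apply: eq_bigr => C _; rewrite expr1n.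
have -> : \sum_(C in P) 1 ^+ 2 * block_diag #|C| = \sum_(C in P) block_diag #|C|.
  by apply: eq_bigr => C _; rewrite expr1n mul1r.
set A := \sum_(C in P) block_value _; set B := \sum_(C in P) block_diag _.
have B_ge0 : 0 <= B.
  by apply: sumr_ge0 => C /size_comp; rewrite /block_diag; do 2 case: ifP => //; lra.
have surplus : k / 4%:R <= A + k - B / 2%:R - 3%:R / 4%:R * #|S|.-1%:R.
  have: 0 <= \sum_(C in P) (block_value #|C| + 3%:R / 4%:R
          - 1 / 2%:R * block_diag #|C| - 3%:R / 4%:R * #|C|%:R).
    apply: sumr_ge0 => C /size_comp.
    by case: #|C| => [|[|[|[|n]]]] // _; rewrite /block_value /block_diag /=; lra.
  rewrite !sumrB big_split /= -!mulr_sumr -natr_sum sum_sizes sumr_const.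
  rewrite -[_ *+ #|P|]mulr_natl -/k -/A -/B; lra.
have S_gt0 : #|S|%:R = #|S|.-1%:R + 1 :> R.
  by rewrite natr1 prednK // (leq_trans _ S_ge5).
rewrite /three_quarters S_gt0 q2; set n : R := _.-1%:R in surplus *.
have -> : 2%:R * (i / 2%:R) * (2%:R * q * k - B) = 2%:R * k - i * B.
  by transitivity (2%:R * (i * q) * k - i * B); [field | rewrite iq mulr1].
have -> : (i / 2%:R) ^+ 2 * (k + k) ^+ 2 = k.
  by transitivity (i ^+ 2 * k * k); [field | rewrite -q2 -exprMn iq expr1n mul1r].
have : i * B <= 1 / 2%:R * B by apply: ler_wpM2r.
lra.
Qed.

(** The parameters are tuned for three components with two vertices each, where
the estimate is an equality; the larger coefficient 7 / 6 at components that are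
single vertices is needed when they occur. *)
Lemma certifiable_hub3 : #|P| = 3%N -> certifiable R s S.
Proof.
move=> k3; pose b n : R := if n == 1%N then 7%:R / 6%:R else 1.
have c_ge0 : 0 <= 3%:R / 14%:R :> R by lra.
apply: certified_le (hub_star 2%:R b c_ge0).
have S_gt0 : #|S|%:R = #|S|.-1%:R + 1 :> R.
  by rewrite natr1 prednK // (leq_trans _ S_ge5).
have S_gt4 : (4 <= #|S|.-1)%N by rewrite -ltnS prednK // (leq_trans _ S_ge5).
rewrite /three_quarters S_gt0; move: S_gt4; rewrite -sum_sizes natr_sum.
have: size (enum P) = 3%N by rewrite -cardE.
rewrite -!big_enum /=; have: {subset enum P <= P} by move=> C; rewrite mem_enum.
case: (enum P) => [|C1 [|C2 [|C3 [|C4 r]]]] // sub _.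
have [s1 s2 s3] : [/\ (0 < #|C1| <= 3)%N, (0 < #|C2| <= 3)%N & (0 < #|C3| <= 3)%N].
  by split; apply/size_comp/sub; rewrite !inE eqxx ?orbT.
rewrite !big_cons !big_nil /b /block_value /block_diag; move: s1 s2 s3.
case: #|C1| => [|[|[|[|?]]]] // _; case: #|C2| => [|[|[|[|?]]]] // _;
  by case: #|C3| => [|[|[|[|?]]]] // _ //= _; lra.
Qed.

Lemma hub_pair_list C D (c d : seq G) : P = [set C; D] -> C != D ->
  C = [set u in c] -> D = [set u in d] -> uniq c -> uniq d ->
  [/\ uniq (rcons c v ++ d), S = [set u in rcons c v ++ d]
    & forall x y, x \in c -> y \in d -> x /~ y].
Proof.
move=> defP CD defC defD Uc Ud.
have CP : C \in P by rewrite defP !inE eqxx.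
have DP : D \in P by rewrite defP !inE eqxx orbT.
have sep x y : x \in c -> y \in d -> ~~ ((x == y) || adj x y).
  move=> xc yd; apply: contra CD => xy; apply/eqP.
  by apply: (comps_eq CP DP _ _ xy); rewrite ?defC ?defD inE.
have vN (r : seq G) E : E = [set u in r] -> E \in P -> v \notin r.
  move=> defE /compsP[_ _ /subsetP sE]; apply/negP => vr.
  by have := sE v; rewrite defE !inE eqxx => /(_ vr).
split.
- rewrite cat_uniq rcons_uniq (vN _ _ defC CP) Uc Ud !andbT /=.
  apply/hasPn => y yd /=; rewrite mem_rcons inE negb_or.
  rewrite (contraNneq _ (vN _ _ defD DP)) => [|<-//]; apply/negP => yc.
  by have := sep y y yc yd; rewrite eqxx.
- rewrite -(setD1K vS) -(cover_comps (S :\ v)) defP /cover bigcup_setU !big_set1.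
  rewrite defC defD; apply/setP => u.
  by rewrite !inE mem_cat mem_rcons inE orbA.
by move=> x y xc yd; have := sep x y xc yd; rewrite negb_or => /andP[_ /negbTE].
Qed.

(** The sizes are (1, 3), (2, 2), (2, 3) or (3, 3).  For (2, 2), unless v is
adjacent to all four vertices, the set is also seen from another cut vertex as
an instance of [certifiable_path5]. *)
Lemma certifiable_hub_pair C D : P = [set C; D] -> C != D -> (#|C| <= #|D|)%N ->
  certifiable R s S.
Proof.
move=> defP CD leCD.
have CP : C \in P by rewrite defP !inE eqxx.
have DP : D \in P by rewrite defP !inE eqxx orbT.
have [_ cC _] := compsP CP; have [_ cD _] := compsP DP.
have [x0 x0C vx0] := comps_edge cS vS CP; have [y0 y0D vy0] := comps_edge cS vS DP.
have /andP[C_gt0 C_le3] := size_comp CP; have /andP[D_gt0 D_le3] := size_comp DP.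
have sizes : (#|C| + #|D|)%N = #|S|.-1.
  by rewrite -sum_sizes defP big_setU1 ?inE //= big_set1.
have CD_ge4 : (4 <= #|C| + #|D|)%N.
  by rewrite sizes -ltnS prednK // (leq_trans _ S_ge5).
have pairs := hub_pair_list defP CD.
have vxC c x : C = [set u in c] -> x \in c -> x \in C by move=> ->; rewrite inE.
case cardC: #|C| C_gt0 C_le3 leCD CD_ge4 => [|[|[|[|//]]]] // _ _ leCD CD_ge4.
- have /cards1P[w defC] : #|C| == 1%N by rewrite cardC.
  have {x0C} wv : w ~~ v by move: x0C vx0; rewrite defC inE adj_sym => /eqP->.
  have cardD : #|D| = 3%N by apply/eqP; rewrite eqn_leq D_le3.
  have {}defC : C = [set u in [:: w]] by apply/setP => u; rewrite defC !inE.
  have [x y z Ud defD vx xy yz|x y z Ud defD vy yx yz vx vz xz] :=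
    triple_atP cD cardD y0D vy0.
    have [U -> sep] := pairs _ _ defC defD isT Ud.
    by apply: certifiable_path5 => //; split; rewrite // sep ?inE ?eqxx ?orbT.
  have [U -> sep] := pairs _ _ defC defD isT Ud.
  by apply: certifiable_fork5 => //; split; rewrite // sep ?inE ?eqxx ?orbT.
- have [b x0b defC] := conn_pair cC cardC x0C.
  have {}defC : C = [set u in [:: b; x0]].
    by rewrite defC; apply/setP => u; rewrite !inE orbC.
  have Uc : uniq [:: b; x0] by rewrite /= inE eq_sym adj_neq.
  have bx0 : b ~~ x0 by rewrite adj_sym.
  have x0v : x0 ~~ v by rewrite adj_sym.
  have /orP[/eqP cardD|/eqP cardD] : (#|D| == 2%N) || (#|D| == 3%N).
  + by case: #|D| leCD D_le3 => [|[|[|[|]]]].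
  + have [d y0d defD] := conn_pair cD cardD y0D.
    have Ud : uniq [:: y0; d] by rewrite /= inE adj_neq.
    have [U -> sep] := pairs _ _ defC defD Uc Ud.
    have [bv|/negbTE bv] := boolP (adj b v); last first.
      by apply: certifiable_path5 => //; split; rewrite // sep ?inE ?eqxx ?orbT.
    have [vd|/negbTE vd] := boolP (adj v d).
      by apply: certifiable_bowtie => //; split; rewrite // sep ?inE ?eqxx ?orbT.
    have -> : [set u in rcons [:: b; x0] v ++ [:: y0; d]] = [set u in [:: d; y0; v; x0; b]].
      by apply/setP => u; rewrite [LHS]inE [RHS]inE -mem_rev.
    have {}U : uniq [:: d; y0; v; x0; b] by rewrite -rev_uniq.
    apply: certifiable_path5 => //; split; rewrite // adj_sym // ?sep ?inE ?eqxx ?orbT //.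
  + have [x y z Ud defD vx xy yz|x y z Ud defD vy yx yz vx vz xz] :=
      triple_atP cD cardD y0D vy0.
      have [U -> sep] := pairs _ _ defC defD Uc Ud.
      by apply: certifiable_path6 => //; split; rewrite // sep ?inE ?eqxx ?orbT.
    have [U -> sep] := pairs _ _ defC defD Uc Ud.
    by apply: certifiable_fork6 => //; split; rewrite // sep ?inE ?eqxx ?orbT.
have cardD : #|D| = 3%N by apply/eqP; rewrite eqn_leq D_le3.
have cardC3 : #|C| = 3%N by rewrite cardC.
have rev3 E (a b c : G) : uniq [:: a; b; c] -> E = [set u in [:: a; b; c]] ->
    uniq [:: c; b; a] /\ E = [set u in [:: c; b; a]].
  move=> U ->; split; first by rewrite -rev_uniq.
  by apply/setP => u; rewrite [LHS]inE [RHS]inE -mem_rev.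
have rot3 E (a b c : G) : uniq [:: a; b; c] -> E = [set u in [:: a; b; c]] ->
    uniq [:: b; c; a] /\ E = [set u in [:: b; c; a]].
  move=> U ->; split; first by rewrite -[uniq _]/(uniq (rot 1 [:: a; b; c])) rot_uniq.
  by apply/setP => u; rewrite [LHS]inE [RHS]inE -(mem_rot 1 [:: a; b; c]).
have [x y z Ud defD vx xy yz|x y z Ud defD vy yx yz vx vz xz] :=
  triple_atP cD cardD y0D vy0;
have [x' y' z' Uc defC vx' xy' yz'|x' y' z' Uc defC vy' yx' yz' vx' vz' xz'] :=
  triple_atP cC cardC3 x0C vx0.
- have {Uc defC}[Uc defC] := rev3 _ _ _ _ Uc defC.
  have [U -> sep] := pairs _ _ defC defD Uc Ud.
  by apply: certifiable_path7 => //; split;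
  solve [by [] | by rewrite adj_sym | by rewrite sep ?inE ?eqxx ?orbT].
- have {Uc defC}[Uc defC] := rot3 _ _ _ _ Uc defC.
  have [U -> sep] := pairs _ _ defC defD Uc Ud.
  by apply: certifiable_clawpath7 => //; split;
  solve [by [] | by rewrite adj_sym | by rewrite sep ?inE ?eqxx ?orbT].
- have defP' : P = [set D; C] by rewrite defP setUC.
  have DC : D != C by rewrite eq_sym.
  have {Ud defD}[Ud defD] := rot3 _ _ _ _ Ud defD.
  have [U -> sep] := hub_pair_list defP' DC defD defC Ud Uc.
  by apply: certifiable_clawpath7 => //; split;
  solve [by [] | by rewrite adj_sym | by rewrite sep ?inE ?eqxx ?orbT].
have {Uc defC}[Uc defC] := rot3 _ _ _ _ Uc defC.
have [U -> sep] := pairs _ _ defC defD Uc Ud.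
by apply: certifiable_clawclaw7 => //; split;
  solve [by [] | by rewrite adj_sym | by rewrite sep ?inE ?eqxx ?orbT].
Qed.

Lemma certifiable_hub : certifiable R s S.
Proof.
have [k_ge4|] := leqP 4 #|P|; first exact: certifiable_hub4.
rewrite ltnS leq_eqVlt => /orP[/eqP|]; first exact: certifiable_hub3.
rewrite ltnS leq_eqVlt => /orP[/cards2P[C [D [CD defP]]]|].
  have [leCD|/ltnW leDC] := leqP #|C| #|D|.
    exact: certifiable_hub_pair defP CD leCD.
  apply: (@certifiable_hub_pair D C) => //; last by rewrite eq_sym.
  by rewrite defP setUC.
rewrite ltnS => P_le1; have: (\sum_(D in P) #|D| <= \sum_(D in P) 3)%N.
  by apply: leq_sum => D /small.
rewrite sum_sizes sum_nat_const => S_le; have := leq_trans S_le (leq_mul P_le1 (leqnn 3)).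
by rewrite leqNgt -ltnS prednK ?(leq_trans _ S_ge5) // S_ge5.
Qed.

End AtHub.

Lemma certifiable_conn (s : bool) S : conn S -> (4 <= #|S|)%N -> certifiable R s S.
Proof.
have [n] := ubnP #|S|; elim: n S => // n IHn S; rewrite ltnS => S_le cS.
rewrite leq_eqVlt => /orP[/eqP S4|S_ge5]; first exact: certifiable_four.
have [/exists_inP[v vS /forall_inP small]|] :=
    boolP [exists v in S, [forall D in comps (S :\ v), #|D| <= 3]%N].
  exact: (certifiable_hub s cS vS S_ge5 small).
rewrite negb_exists_in => /forall_inP big.
apply: certified_bag_step => // [T cT /andP[T4 TS]||v vS].
- by apply: IHn => //; apply: leq_trans TS S_le.
- by rewrite -card_gt0 (leq_trans _ S_ge5).
have := big v vS; rewrite negb_forall_in => /exists_inP[D Dv].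
by rewrite -ltnNge; exists D.
Qed.


End Hub.

(** * The lower bound *)

Theorem theorem4 (R : realType) (G : sgraph) (n : nat)
  (connected_G : graph_connected G) (order_G : graph_order G = n) (n_ge4 : (4 <= n)%N) :
  3%:R * n%:R / 4%:R <= square_energy R G.
Proof.
have cG := graph_connected_conn connected_G.
have cardG : #|[set: G]| = n by rewrite cardsT.
have bound s : 3%:R * n%:R / 4%:R <=
    (if s then neg_square_energy R G else pos_square_energy R G).
  apply: certified_energy; rewrite -cardG; apply: certifiable_conn => //.
  by rewrite cardG.
by rewrite /square_energy le_min (bound false) (bound true).
Qed.
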